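(* Let $u_h^{cr}\in K_h^{cr}$ be a minimizer of $I_h^{cr}$ (a discrete primal solution). Then the following statements hold. (i) The (Fenchel) dual problem to the minimization of $I_h^{cr}$ is given via the maximization of $D_h^{rt}$. (ii) There exists a unique maximizer $z_h^{rt}\in\mathcal{R}T^0(\mathcal{T}_h)$ of $D_h^{rt}$, and it satisfies the discrete admissibility conditions $\mathrm{div}\,z_h^{rt}=-f_h$ a.e. in $\Omega$ and $z_h^{rt}\cdot n=g_h$ a.e. on $\Gamma_N$. In addition, the discrete strong duality relation $I_h^{cr}(u_h^{cr})=D_h^{rt}(z_h^{rt})$ holds. (iii) The following discrete convex optimality relations hold: $$\Pi_hz_h^{rt}=\nabla_hu_h^{cr}\ \text{ a.e. in }\Omega,\qquad -(z_h^{rt}\cdot n,\pi_hu_h^{cr})_{\Gamma_I}=\tfrac m2\|z_h^{rt}\cdot n\|_{\infty,\Gamma_I}^2+\tfrac1{2m}\|\pi_hu_h^{cr}\|_{1,\Gamma_I}^2.$$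
   Context: Setting. $\Omega\subseteq\mathbb{R}^d$, $d\in\mathbb{N}$, is a bounded simplicial (polyhedral) Lipschitz domain with outward unit normal $n$, whose boundary is split into three relatively open parts $\Gamma_I\neq\emptyset$, $\Gamma_D$, $\Gamma_N$, with $\partial\Omega=\overline{\Gamma}_I\cup\overline{\Gamma}_D\cup\overline{\Gamma}_N$. $(\cdot,\cdot)_\omega$ is the integral of the (Euclidean) product over $\omega$ (surface measure if $\omega\subseteq\partial\Omega$), $\|\cdot\|_{p,\omega}$ the $L^p(\omega)$-norm, $\|\cdot\|_\omega=\|\cdot\|_{2,\omega}$, $\langle v\rangle_\omega$ the integral mean. Mesh. $\mathcal{T}_h$ is a (conforming, simplicial) triangulation of $\Omega$ from a shape-regular family; $\mathcal{S}_h=\mathcal{S}_h^i\cup\mathcal{S}_h^\partial$ are its interior and boundary sides; $\mathcal{S}_h^X$, $X\in\{I,D,N\}$, are the boundary sides with interior contained in $\Gamma_X$, and $\mathcal{S}_h^\partial=\mathcal{S}_h^I\,\dot\cup\,\mathcal{S}_h^D\,\dot\cup\,\mathcal{S}_h^N$. $\mathcal{L}^k(\mathcal{T}_h)$ and $\mathcal{L}^k(\widehat{\mathcal{S}}_h)$ are the element-wise, resp. side-wise (on a set $\widehat{\mathcal S}_h$ of sides), polynomials of degree at most $k$. $\Pi_h$: element-wise mean, $\Pi_hv|_T=\langle v\rangle_T$; $\pi_h$: side-wise mean, $\pi_hv|_S=\langle v\rangle_S$ (componentwise for vector fields). Crouzeix–Raviart space: $\mathcal{S}^{1,cr}(\mathcal{T}_h)=\{v_h\in\mathcal{L}^1(\mathcal{T}_h):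 \text{the jump of }v_h\text{ across each }S\in\mathcal{S}_h^i\text{ has mean zero on }S\}$; $\nabla_h$ is the element-wise gradient. Raviart–Thomas space: $\mathcal{R}T^0(\mathcal{T}_h)=\{y_h\in(\mathcal{L}^1(\mathcal{T}_h))^d: y_h|_T\cdot n_T\text{ is constant on each side of }T\text{ for every }T\in\mathcal{T}_h,\text{ and the normal jump of }y_h\text{ vanishes across each }S\in\mathcal{S}_h^i\}$, where $n_T$ is the outward unit normal to $T$. Data: $m>0$, $f_h\in\mathcal{L}^0(\mathcal{T}_h)$, $g_h\in\mathcal{L}^0(\mathcal{S}_h^N)$, $u_D^h\in\mathcal{L}^0(\mathcal{S}_h^D)$. Discrete primal functional $I_h^{cr}\colon\mathcal{S}^{1,cr}(\mathcal{T}_h)\to\mathbb{R}\cup\{+\infty\}$: $I_h^{cr}(v_h)=\tfrac12\|\nabla_hv_h\|_\Omega^2+\tfrac1{2m}\|\pi_hv_h\|_{1,\Gamma_I}^2-(f_h,\Pi_hv_h)_\Omega-(g_h,\pi_hv_h)_{\Gamma_N}$ if $\pi_hv_h=u_D^h$ a.e. on $\Gamma_D$, and $+\infty$ otherwise. Its effective domain is $K_h^{cr}=\{v_h\in\mathcal{S}^{1,cr}(\mathcal{T}_h):\pi_hv_h=u_D^h\text{ a.e. on }\Gamma_D\}$. A minimizer of $I_h^{cr}$ exists. Discrete dual functional $D_h^{rt}\colon\mathcal{R}T^0(\mathcal{T}_h)\to\mathbb{R}\cup\{-\infty\}$: $D_h^{rt}(y_h)=-\tfrac12\|\Pi_hy_h\|_\Omega^2-\tfrac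 m2\|y_h\cdot n\|_{\infty,\Gamma_I}^2+(y_h\cdot n,u_D^h)_{\Gamma_D}$ if $\mathrm{div}\,y_h=-f_h$ a.e. in $\Omega$ and $y_h\cdot n=g_h$ a.e. on $\Gamma_N$, and $-\infty$ otherwise. The term ''(Fenchel) dual problem'' is meant in the sense of Ekeland–Temam: for a functional of the form $v\mapsto G(\Lambda v)+F(v)$ with $G,F$ proper, convex, lower semi-continuous and $\Lambda$ linear and bounded (here $\Lambda=\nabla_h\colon\mathcal{S}^{1,cr}(\mathcal{T}_h)\to(\mathcal{L}^0(\mathcal{T}_h))^d$), it is the maximization of $y\mapsto-G^*(y)-F^*(-\Lambda^*y)$, with $G^*,F^*$ the Fenchel conjugates and $\Lambda^*$ the adjoint; here dual variables in $(\mathcal{L}^0(\mathcal{T}_h))^d$ are represented in the form $\Pi_hy_h$ with $y_h\in\mathcal{R}T^0(\mathcal{T}_h)$. *)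

(* Defs.v *)
From HB Require Import structures.
From mathcomp Require Import all_boot all_order all_algebra.
From mathcomp Require Import all_classical all_reals all_analysis.
From mathcomp Require Import ring.

Set Implicit Arguments.
Unset Strict Implicit.
Unset Printing Implicit Defensive.

Import Order.TTheory GRing.Theory Num.Theory.
Import numFieldNormedType.Exports.

Local Open Scope classical_set_scope.
Local Open Scope ring_scope.

Section FenchelDuality.
Context {R : realType}.
Local Open Scope ereal_scope.

Definition proper_fun (V : Type) (F : V -> \bar R) :=
  (forall v, F v != -oo) /\ (exists v, F v != +oo).

Definition convex_efun (V : lmodType R) (F : V -> \bar R) :=
  forall (u v : V) (t : R), (0 < t < 1)%R ->
    F (t *: u + (1 - t) *: v)%R <= t%:E * F u + (1 - t)%:E * F v.

Definition fenchel_splitting (V Y : preTopologicalLmodType R) (L : V -> Y)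
    (G : Y -> \bar R) (F : V -> \bar R) (J : V -> \bar R) : Prop :=
  [/\ linear L /\ continuous L,
      [/\ proper_fun G, convex_efun G & lower_semicontinuous G],
      [/\ proper_fun F, convex_efun F & lower_semicontinuous F]
    & forall v, J v = G (L v) + F v].

Definition conjugate (V : Type) (F : V -> \bar R) (l : V -> R) : \bar R :=
  ereal_sup [set (l v)%:E - F v | v in [set: V]].

(* Objective of the Ekeland-Temam dual problem at a linear functional l on Y; the
   adjoint of L sends l to l \o L. *)
Definition fenchel_dual (V Y : Type) (L : V -> Y) (G : Y -> \bar R)
    (F : V -> \bar R) (l : Y -> R) : \bar R :=
  - conjugate G l - conjugate F (fun v => - l (L v))%R.

End FenchelDuality.

Section Euclidean.
Context {R : realType}.

Definition dot (d : nat) (u v : 'rV[R]_d) : R := (u *m v^T) 0 0.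

(* Lebesgue integral over the simplex {x | 0 <= x_i, \sum_i x_i <= s} of R^k,
   as an iterated integral; for k = 0 this is evaluation at the only point *)
Fixpoint ref_int (k : nat) (s : R) : ('rV[R]_k -> R) -> R :=
  match k with
  | 0%N => fun f => f 0
  | k'.+1 => fun f => \int[lebesgue_measure]_(t in `[0, s])
      ref_int (s - t) (fun x : 'rV[R]_k' => f (row_mx (t%:M : 'rV[R]_1) x))
  end.

(* The affine function x |-> v.1 + v.2 . x *)
Definition aff (d : nat) (v : R^o * 'rV[R]_d) (x : 'rV[R]_d) : R :=
  v.1 + dot v.2 x.

Definition grad (d : nat) (v : R^o * 'rV[R]_d) : 'rV[R]_d := v.2.

(* The affine vector field x |-> y.1 + x *m y.2 *)
Definition vaff (d : nat) (y : 'rV[R]_d * 'M[R]_d) (x : 'rV[R]_d) : 'rV[R]_d :=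
  y.1 + x *m y.2.

Definition divergence (d : nat) (y : 'rV[R]_d * 'M[R]_d) : R := \tr y.2.

Lemma dotE d (u v : 'rV[R]_d) : dot u v = \sum_i u 0 i * v 0 i.
Proof. by rewrite /dot mxE; apply: eq_bigr => i _; rewrite mxE. Qed.

Lemma is_derive_dot d (u v x : 'rV[R]_d) : is_derive x v (dot u) (dot u v).
Proof.
have dotl : linear (dot u : 'rV[R]_d -> R^o).
  by move=> a y z; rewrite /dot linearP mulmxDr -scalemxAr !mxE.
pose L := GRing.isLinear.Build R _ R^o _ (dot u : 'rV[R]_d -> R^o) dotl.
pose f : {linear 'rV[R]_d -> R^o} := HB.pack (dot u : 'rV[R]_d -> R^o) L.
have E h : h != 0 -> h^-1 *: ((dot u \o shift x) (h *: v) - dot u x) = dot u v.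
  move=> h0 /=; rewrite -[dot u x]/(f x) -[dot u (_ + _)]/(f (h *: v + x)).
  by rewrite linearP addrK scalerA mulVf// scale1r.
have cv : h^-1 *: ((dot u \o shift x) (h *: v) - dot u x) @[h --> 0^']
    --> (dot u v : R).
  apply: cvg_near_cst; near=> h; apply: E.
  by near: h; exact: nbhs_dnbhs_neq.
split; first by apply: cvgP cv.
exact: cvg_lim cv.
Unshelve. all: by end_near. Qed.

Lemma derive_aff d (v : R^o * 'rV[R]_d) (x u : 'rV[R]_d) :
  'D_u (aff v) x = dot (grad v) u.
Proof.
have H := is_derive_dot v.2 u x.
have H1 : is_derive x u (aff v) (0 + dot v.2 u).
  by apply: is_deriveD.
by rewrite derive_val add0r.
Qed.

Lemma derive_vaff d (y : 'rV[R]_d * 'M[R]_d) (x : 'rV[R]_d) :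
  \sum_i 'D_(delta_mx 0 i) (fun z => vaff y z 0 i) x = divergence y.
Proof.
apply: eq_bigr => i _.
have -> : (fun z => vaff y z 0 i) = aff (y.1 0 i : R^o, (col i y.2)^T).
  apply/funext => z; rewrite /aff /vaff /= !mxE dotE; congr (_ + _).
  by apply: eq_bigr => j _; rewrite !mxE mulrC.
rewrite derive_aff /grad dotE (bigD1 i)//= big1 ?addr0; last first.
  by move=> j ji; rewrite !mxE (negbTE ji) andbF mulr0.
by rewrite !mxE !eqxx mulr1.
Qed.

Lemma Rintegral_deriv (p : {poly R}) (s : R) : 0 <= s ->
  \int[lebesgue_measure]_(t in `[0, s]) p^`().[t] = p.[s] - p.[0].
Proof.
rewrite le_eqVlt => /predU1P[<-|s0].
  by rewrite set_itv1 Rintegral_set1 subrr.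
rewrite /Rintegral (@continuous_FTC2 _ _ (horner p) 0 s)//.
- by apply: continuous_subspaceT => x; exact: continuous_horner.
- split.
  + by move=> x _; exact: derivable_horner.
  + by apply: cvg_at_right_filter; exact: continuous_horner.
  + by apply: cvg_at_left_filter; exact: continuous_horner.
- by move=> x _; rewrite derivE.
Qed.

Lemma dot_row_mx k (b : 'rV[R]_(1 + k)) t (x : 'rV[R]_k) :
  dot b (row_mx t%:M x) = b 0 0 * t + dot (rsubmx b) x.
Proof.
rewrite !dotE big_split_ord big_ord1/= row_mxEl mxE eqxx mulr1n.
congr (b _ _ * _ + _); first exact: val_inj.
by apply: eq_bigr => i _; rewrite row_mxEr mxE.
Qed.

Lemma ref_int_aff k (s c : R) (b : 'rV[R]_k) : 0 <= s ->
  ref_int s (fun x => c + dot b x) =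
  c * s ^+ k / k`!%:R + (\sum_i b 0 i) * s ^+ k.+1 / k.+1`!%:R.
Proof.
elim: k s c b => [|k IH] s c b s0.
  by rewrite /= dotE !big_ord0 expr0 fact0 !mulr1 divr1 mul0r mul0r.
rewrite [LHS]/=; set B := \sum_i (rsubmx (b : 'rV_(1 + k))) 0 i.
have eB : \sum_i b 0 i = b 0 0 + B.
  rewrite big_ord_recl; congr (_ + _); apply: eq_bigr => i _.
  by rewrite mxE; congr (b _ _); exact: val_inj.
pose a := b 0 0.
pose q : {poly R} := s%:P - 'X.
pose p : {poly R} := - ((c%:P + a%:P * 'X) * q ^+ k.+1 * (k.+1`!%:R^-1)%:P
  + (a + B)%:P * q ^+ k.+2 * (k.+2`!%:R^-1)%:P).
have F0 j : (j`!%:R : R) != 0 by rewrite pnatr_eq0 -lt0n fact_gt0.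
have N0 j : (j.+1%:R : R) != 0 by rewrite pnatr_eq0.
under eq_Rintegral => t.
  rewrite inE/= in_itv/= => /andP[t0 ts].
  under [X in ref_int _ X]eq_fun do rewrite dot_row_mx addrA.
  rewrite IH ?subr_ge0// -/B -/a.
  rewrite (_ : _ + _ = p^`().[t]); last first.
    have dq j : (q ^+ j.+1)^`().[t] = - (j.+1%:R * (s - t) ^+ j).
      rewrite deriv_exp /q derivB derivC derivX sub0r mulN1r hornerMn hornerN.
      by rewrite horner_exp !hornerE -mulr_natl mulrN.
    have dp (u v : {poly R}) (e x y : R) :
      (- ((c%:P + a%:P * 'X) * u * x%:P + e%:P * v * y%:P))^`().[t] =
      - ((a * u.[t] + (c + a * t) * u^`().[t]) * x + e * v^`().[t] * y).
      rewrite derivN derivD !derivM !derivC derivD derivC derivM derivC derivX.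
      by rewrite !hornerE /= ?mulr0 ?add0r ?addr0; ring.
    rewrite /p dp !dq.
    have hq j : (q ^+ j).[t] = (s - t) ^+ j by rewrite horner_exp !hornerE.
    rewrite !hq.
    rewrite (factS k.+1) (factS k) !natrM.
    have := F0 k; have := N0 k; have := N0 k.+1.
    rewrite exprS -[k.+2%:R]natr1 -[k.+1%:R]natr1.
    move: (k`!%:R : R) (k%:R : R) => F K H1 H2 H3.
    set z := (s - t) ^+ k. field.
    by rewrite H1 H2 H3.
  over.
have hq t j : (q ^+ j).[t] = (s - t) ^+ j by rewrite horner_exp !hornerE.
have hp t (u v : {poly R}) (e x y : R) :
    (- ((c%:P + a%:P * 'X) * u * x%:P + e%:P * v * y%:P)).[t] =
    - ((c + a * t) * u.[t] * x + e * v.[t] * y) by rewrite !hornerE.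
rewrite Rintegral_deriv// /p !hp !hq subrr !subr0 !expr0n/= eB -/a; ring.
Qed.
End Euclidean.

(* A simplicial complex given by labelled points and the vertex sets of its
   top-dimensional cells *)
Record mesh (R : realType) (d : nat) := Mesh {
  node : finType;
  pos : node -> 'rV[R]_d;
  cells : {set {set node}}
}.

Section Simplices.
Context {R : realType} {d : nat} (M : mesh R d).
Implicit Types A : {set node M}.

Definition hull A : set 'rV[R]_d :=
  [set x | exists w : node M -> R, [/\ forall a, a \in A -> 0 <= w a,
     \sum_(a in A) w a = 1 & x = \sum_(a in A) w a *: pos a]].

Definition relint A : set 'rV[R]_d :=
  [set x | exists w : node M -> R, [/\ forall a, a \in A -> 0 < w a,
     \sum_(a in A) w a = 1 & x = \sum_(a in A) w a *: pos a]].

Definition vtx A (i : nat) : 'rV[R]_d := nth 0 [seq pos a | a <- enum A] i.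

Definition edge_mx (k : nat) A : 'M[R]_(k, d) :=
  \matrix_(i < k) (vtx A i.+1 - vtx A 0).

(* Integral of f over the k-simplex hull A, #|A| = k + 1, with respect to the
   k-dimensional surface measure, computed in the affine parametrization by the
   reference simplex: the Jacobian factor is the square root of the Gram
   determinant. It is the Lebesgue integral for k = d, and the counting measure
   for k = 0. *)
Definition simplex_int (k : nat) A (f : 'rV[R]_d -> R) : R :=
  Num.sqrt (\det (edge_mx k A *m (edge_mx k A)^T)) *
  ref_int 1 (fun t : 'rV[R]_k => f (vtx A 0 + t *m edge_mx k A)).

Definition mean (k : nat) A (f : 'rV[R]_d -> R) : R :=
  simplex_int k A f / simplex_int k A (fun=> 1).

Lemma simplex_int_aff k A (a : R) (u v : R^o * 'rV[R]_d) :
  simplex_int k A (aff (a *: u + v)) =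
  a * simplex_int k A (aff u) + simplex_int k A (aff v).
Proof.
have E (w : R^o * 'rV[R]_d) : (fun t : 'rV[R]_k => aff w (vtx A 0 + t *m edge_mx k A)) =
    (fun t => aff w (vtx A 0) + dot (w.2 *m (edge_mx k A)^T) t).
  apply/funext => t; rewrite /aff /dot -addrA; congr (_ + _).
  by rewrite linearD/= mulmxDr mxE trmx_mul mulmxA.
have L (w z : R^o * 'rV[R]_d) x : aff (a *: w + z) x = a * aff w x + aff z x.
  rewrite /aff /= /dot mulmxDl -scalemxAl !mxE /GRing.scale/=; ring.
rewrite /simplex_int !E !ref_int_aff// L/= mulmxDl -scalemxAl.
pose E' := (edge_mx k A)^T; rewrite -/E'.
rewrite (eq_bigr (fun i => a * (u.2 *m E') 0 i + (v.2 *m E') 0 i)); last first.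
  by move=> i _; rewrite mxE [in LHS]mxE.
by rewrite big_split/= -mulr_sumr !expr1n; ring.
Qed.

End Simplices.

(* Bounded Lipschitz domains of R^n.+1: near each boundary point, in coordinates
   (t, y) with respect to a rotated frame, Omega lies above the graph of a
   Lipschitz function of y. *)
Definition lipschitz_domain (R : realType) (n : nat) (Omega : set 'rV[R]_n.+1) :=
  [/\ open Omega, connected Omega, Omega !=set0, bounded_set Omega &
    forall x, (closure Omega `\` Omega) x ->
      exists (Q : 'M[R]_n.+1) (gamma : 'rV[R]_n -> R) (r : R),
        [/\ Q *m Q^T = 1%:M, lipschitz gamma, 0 < r &
          forall (t : R) (y : 'rV[R]_n), `|t| < r -> `|y| < r ->
            (Omega (x + (row_mx (t%:M : 'rV[R]_1) y : 'rV[R]_n.+1) *m Q) <->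
             gamma y < t)]].

Definition boundary_parts (R : realType) (n : nat)
    (Omega GI GD GN : set 'rV[R]_n.+1) :=
  let bd := closure Omega `\` Omega in
  let rel_open G := exists2 U, open U & G = U `&` bd in
  [/\ [/\ rel_open GI, rel_open GD & rel_open GN],
      [/\ GI `&` GD = set0, GI `&` GN = set0 & GD `&` GN = set0],
      GI !=set0
    & bd = closure GI `|` closure GD `|` closure GN].

Section FiniteElements.
Context {R : realType} {n : nat} (M : mesh R n.+1).

(* Conforming triangulation of Omega *)
Definition triangulation (Omega : set 'rV[R]_n.+1) :=
  [/\ injective (@pos _ _ M),
      forall A, A \in cells M -> #|A| = n.+2 /\ row_free (edge_mx n.+1 A),
      forall A B, A \in cells M -> B \in cells M ->
        hull A `&` hull B = hull (A :&: B)
    & closure Omega = \bigcup_(A in [set` cells M]) hull A].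

Definition cell : Type := {A : {set node M} | A \in cells M}.
HB.instance Definition _ := SubFinite.on cell.

Definition is_side (S : {set node M}) : bool :=
  (#|S| == n.+1) && [exists A in cells M, S \subset A].

Definition side : Type := {S : {set node M} | is_side S}.
HB.instance Definition _ := SubFinite.on side.

Implicit Types (T : cell) (S : side).

Definition adj S : {set cell} := [set T : cell | sval S \subset sval T].

Definition interior_side S : bool := (1 < #|adj S|)%N.

Definition boundary_sides : {set side} := [set S : side | ~~ interior_side S].

(* The boundary sides with (relative) interior contained in G *)
Definition sides_in (G : set 'rV[R]_n.+1) : {set side} :=
  [set S : side | (S \in boundary_sides) && `[< relint (sval S) `<=` G >]].

Definition compatible_sides (GI GD GN : set 'rV[R]_n.+1) :=
  [/\ boundary_sides = (sides_in GI :|: sides_in GD :|: sides_in GN)%SET,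
      (sides_in GI :&: sides_in GD)%SET = finset.set0,
      (sides_in GI :&: sides_in GN)%SET = finset.set0
    & (sides_in GD :&: sides_in GN)%SET = finset.set0].

(* The outward unit normal to T on its side S *)
Definition normal T S : 'rV[R]_n.+1 :=
  xget 0 [set nu | [/\ dot nu nu = 1,
    forall a b, a \in sval S -> b \in sval S -> dot nu (pos a - pos b) = 0
  & forall a b, a \in sval T :\: sval S -> b \in sval S ->
      dot nu (pos a - pos b) < 0]].

Definition cell_int T := simplex_int n.+1 (sval T).
Definition side_int S := simplex_int n (sval S).

(* Integrals over Omega, resp. over the union of a set B of sides, of functions
   given element-wise, resp. side-wise *)
Definition domain_int (F : cell -> 'rV[R]_n.+1 -> R) : R :=
  \sum_T cell_int T (F T).
Definition sides_int (B : {set side}) (F : side -> 'rV[R]_n.+1 -> R) : R :=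
  \sum_(S in B) side_int S (F S).

(* Element-wise constant vector fields, and element-wise affine functions and
   vector fields; element-wise and side-wise constant functions are the elements
   of cell -> R and side -> R. *)
Definition L0d : Type := cell -> 'rV[R]_n.+1.
Definition L1 : Type := cell -> R^o * 'rV[R]_n.+1.
Definition L1d : Type := cell -> 'rV[R]_n.+1 * 'M[R]_n.+1.

HB.instance Definition _ := GRing.Lmodule.copy L0d (cell -> 'rV[R]_n.+1).
HB.instance Definition _ :=
  Topological.copy L0d (prod_topology (fun _ : cell => 'rV[R]_n.+1)).
HB.instance Definition _ := GRing.Lmodule.copy L1 (cell -> R^o * 'rV[R]_n.+1).
HB.instance Definition _ :=
  Topological.copy L1 (prod_topology (fun _ : cell => (R^o * 'rV[R]_n.+1)%type)).

Implicit Types (v : L1) (y : L1d) (p q : L0d).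

Definition cr_pred v : bool := [forall S, forall T, forall T',
  [&& interior_side S, T \in adj S & T' \in adj S] ==>
  (side_int S (aff (v T - v T')) == 0)].

(* The trace of y . n on S if S is a boundary side, and the jump of the normal
   component of y across S if S is an interior side *)
Definition normal_trace y S (x : 'rV[R]_n.+1) : R :=
  \sum_(T in adj S) dot (vaff (y T) x) (normal T S).

Definition is_rt y : Prop :=
  (forall S T, T \in adj S -> exists c : R,
     forall x, hull (sval S) x -> dot (vaff (y T) x) (normal T S) = c) /\
  (forall S, interior_side S ->
     forall x, hull (sval S) x -> normal_trace y S x = 0).

Definition CR : Type := {v : L1 | cr_pred v}.
Definition RT : Type := {y : L1d | `[< is_rt y >]}.

Lemma cr_submod : submod_closed cr_pred.
Proof.
split=> [|a u v].
  apply/forallP => S; apply/forallP => T; apply/forallP => T'.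
  apply/implyP => _; have := simplex_int_aff n (sval S) (-1) 0 0.
  by rewrite subr0 scaler0 addr0 mulN1r addNr /side_int => ->.
move=> /forallP hu /forallP hv.
apply/forallP => S; apply/forallP => T; apply/forallP => T'.
apply/implyP => h.
move: (hu S) => /forallP/(_ T)/forallP/(_ T')/implyP/(_ h)/eqP.
move: (hv S) => /forallP/(_ T)/forallP/(_ T')/implyP/(_ h)/eqP.
rewrite /side_int => hv' hu'.
have -> : (a *: u + v) T - (a *: u + v) T' =
   a *: (u T - u T') + (v T - v T').
  by rewrite scalerBr opprD addrACA.
by rewrite simplex_int_aff hu' hv' mulr0 addr0.
Qed.

HB.instance Definition _ := GRing.isSubmodClosed.Build R L1 cr_pred cr_submod.
HB.instance Definition _ := SubChoice.on CR.
HB.instance Definition _ := [SubChoice_isSubLmodule of CR by <:].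
HB.instance Definition _ :=
  Topological.copy CR (initial_topology (sval : CR -> L1)).

HB.instance Definition _ := SubChoice.on RT.

Definition grad_h (v : CR) : L0d := fun T => grad (sval v T).

Definition div_h (y : RT) (T : cell) : R := divergence (sval y T).

(* Element-wise means *)
Definition Pi_h (v : CR) (T : cell) : R := mean n.+1 (sval T) (aff (sval v T)).
Definition Pi_vec_h (y : RT) : L0d :=
  fun T => \row_i mean n.+1 (sval T) (fun x => vaff (sval y T) x 0 i).

(* Side-wise means. The one-sided traces are averaged over the cells containing
   S: there is only one such cell if S is a boundary side, and the two traces
   have the same mean if S is an interior side. *)
Definition pi_h (v : CR) (S : side) : R :=
  (\sum_(T in adj S) mean n (sval S) (aff (sval v T))) / #|adj S|%:R.

Definition l2_dot (p q : L0d) : R := domain_int (fun T _ => dot (p T) (q T)).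

Definition l1_norm (B : {set side}) (w : side -> R) : R :=
  sides_int B (fun S _ => `|w S|).

(* The L^infty norm of y . n on the sides in B; y . n is continuous on each of
   them, so that the essential supremum is a supremum *)
Definition linf_norm (B : {set side}) (y : RT) : R :=
  sup [set r | exists S x,
    [/\ S \in B, hull (sval S) x & r = `|normal_trace (sval y) S x| ]].

Section Functionals.
Variables (GI GD GN : set 'rV[R]_n.+1) (m : R).
(* Only the values of g on sides_in GN and of uD on sides_in GD are used. *)
Variables (f : cell -> R) (g uD : side -> R).

Definition K_cr (v : CR) : Prop :=
  forall S, S \in sides_in GD -> pi_h v S = uD S.

(* The terms of the primal functional other than the gradient term *)
Definition F_real (v : CR) : R :=
  (2 * m)^-1 * l1_norm (sides_in GI) (pi_h v) ^+ 2
  - domain_int (fun T _ => f T * Pi_h v T)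
  - sides_int (sides_in GN) (fun S _ => g S * pi_h v S).

Definition I_cr (v : CR) : \bar R :=
  if `[< K_cr v >] then
    (2^-1 * l2_dot (grad_h v) (grad_h v) + F_real v)%:E
  else +oo%E.

Definition G_h (p : L0d) : \bar R := (2^-1 * l2_dot p p)%:E.

Definition F_h (v : CR) : \bar R :=
  if `[< K_cr v >] then (F_real v)%:E else +oo%E.

Definition rt_admissible (y : RT) : Prop :=
  (forall T, div_h y T = - f T) /\
  (forall S, S \in sides_in GN ->
     forall x, hull (sval S) x -> normal_trace (sval y) S x = g S).

Definition D_rt (y : RT) : \bar R :=
  if `[< rt_admissible y >] then
    (- (2^-1 * l2_dot (Pi_vec_h y) (Pi_vec_h y))
     - m / 2 * linf_norm (sides_in GI) y ^+ 2
     + sides_int (sides_in GD) (fun S x => normal_trace (sval y) S x * uD S))%:E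
  else -oo%E.

End Functionals.
End FiniteElements.

(* Main.v *)
(* Every Raviart-Thomas field is, on each cell, of the form x |-> q + k (x - x_T)
   with x_T the barycenter, so it is determined by its element-wise means and its
   divergence. Writing normals and side measures in terms of the gradients of
   barycentric coordinates, integration by parts on a simplex reads
     (Pi_h y, grad_h v) + (div y, Pi_h v) = \sum_S |S| [y . n]_S (pi_h v)_S,
   and pi_h maps the Crouzeix-Raviart space onto all side-wise constants. Hence
   - (p, grad_h v) - F v depends only on pi_h v. If p = Pi_h y with y admissible,
   its supremum over v is explicit; if there is no such y, it is unbounded, as one
   sees by varying pi_h v on one interior or Neumann side. Minimality of u says
   that the supremum for p = grad_h u is attained at u; in particular it is finite,
   which yields z with Pi_h z = grad_h u, strong duality, and the optimality
   relations. Since D y <= I u - |Pi_h y - grad_h u|^2 / 2, z is the only maximizer. *)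

Require Import Defs.
From HB Require Import structures.
From mathcomp Require Import all_boot all_order all_algebra.
From mathcomp Require Import all_classical all_reals all_analysis.
From mathcomp Require Import fingroup.perm.
From mathcomp Require Import ring lra.

Set Implicit Arguments.
Unset Strict Implicit.
Unset Printing Implicit Defensive.

Import Order.TTheory GRing.Theory Num.Theory.
Import numFieldNormedType.Exports.

Local Open Scope classical_set_scope.
Local Open Scope ring_scope.

(** * The Euclidean product *)

Section Dot.
Context {R : realType} {d : nat}.
Implicit Types u v w : 'rV[R]_d.

Lemma dotC u v : dot u v = dot v u.
Proof. by rewrite !dotE; apply: eq_bigr => i _; rewrite mulrC. Qed.

Lemma dotDl u v w : dot (u + v) w = dot u w + dot v w.
Proof. by rewrite /dot mulmxDl mxE. Qed.

Lemma dotZl (a : R) u w : dot (a *: u) w = a * dot u w.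
Proof. by rewrite /dot -scalemxAl mxE. Qed.

Lemma dotNl u w : dot (- u) w = - dot u w.
Proof. by rewrite -scaleN1r dotZl mulN1r. Qed.

Lemma dotBl u v w : dot (u - v) w = dot u w - dot v w.
Proof. by rewrite dotDl dotNl. Qed.

Lemma dotDr u v w : dot w (u + v) = dot w u + dot w v.
Proof. by rewrite dotC dotDl !(dotC w). Qed.

Lemma dotZr (a : R) u w : dot w (a *: u) = a * dot w u.
Proof. by rewrite dotC dotZl dotC. Qed.

Lemma dotNr u w : dot w (- u) = - dot w u.
Proof. by rewrite dotC dotNl dotC. Qed.

Lemma dotBr u v w : dot w (u - v) = dot w u - dot w v.
Proof. by rewrite dotDr dotNr. Qed.

Lemma dot0l w : dot 0 w = 0.
Proof. by rewrite /dot mul0mx mxE. Qed.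

Lemma dot_suml (I : Type) (r : seq I) (P : pred I) (F : I -> 'rV[R]_d) w :
  dot (\sum_(i <- r | P i) F i) w = \sum_(i <- r | P i) dot (F i) w.
Proof. by rewrite /dot mulmx_suml summxE. Qed.

Lemma dot_ge0 u : 0 <= dot u u.
Proof. by rewrite dotE; apply: sumr_ge0 => i _; rewrite -expr2 sqr_ge0. Qed.

Lemma dot_eq0 u : (dot u u == 0) = (u == 0).
Proof.
apply/eqP/eqP => [|->]; last by rewrite dot0l.
rewrite dotE => /psumr_eq0P H; apply/rowP => i; rewrite mxE.
by apply/eqP; rewrite -sqrf_eq0 expr2 H// => j _; rewrite -expr2 sqr_ge0.
Qed.

End Dot.

(** * Affine functions *)

Section Affine.
Context {R : realType} {d : nat}.
Implicit Types (v w : R^o * 'rV[R]_d) (x y : 'rV[R]_d).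

Lemma affB v x y : aff v x - aff v y = dot v.2 (x - y).
Proof. by rewrite /aff dotBr; ring. Qed.

Lemma aff_linear (a : R) v w x : aff (a *: v + w) x = a * aff v x + aff w x.
Proof. by rewrite /aff/= dotDl dotZl /GRing.scale/=; ring. Qed.

Lemma aff_center (k : nat) (I : finType) (P : pred I) (p : I -> 'rV[R]_d) v :
  #|P| = k.+1 ->
  aff v (k.+1%:R^-1 *: \sum_(i | P i) p i) =
    k.+1%:R^-1 * \sum_(i | P i) aff v (p i).
Proof.
move=> cP; rewrite /aff big_split/= sumr_const cP mulrDr dotZr.
congr (_ + _); last first.
  by congr (_ * _); rewrite dotC dot_suml; apply: eq_bigr => i _; rewrite dotC.
by rewrite -[v.1 *+ _]mulr_natl mulrA mulVf ?mul1r// pnatr_eq0.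
Qed.

End Affine.

(** * Gram determinants and reordering of vertices *)

Section Determinants.
Context {R : realType}.

(* With [C] the matrix of rows [r, E], one has [N = |N|^2 r + w E] for some [w],
   so replacing [r] by [N] multiplies [det C] by [|N|^2]. *)
Lemma gram_height n (E : 'M[R]_(n, n.+1)) (r N : 'rV[R]_(1 + n)) :
  let C := col_mx r E : 'M[R]_(1 + n) in
  C \in unitmx -> E *m N^T = 0 -> dot N r = 1 ->
  \det (E *m E^T) = dot N N * \det C ^+ 2.
Proof.
move=> C uC EN Nr.
pose c := N *m invmx C : 'rV[R]_(1 + n).
have cC : c *m C = N by rewrite /c mulmxKV.
have cE : c = row_mx (lsubmx c) (rsubmx c) by rewrite hsubmxK.
have Ncr : N = lsubmx c *m r + rsubmx c *m E.
  by rewrite -[LHS]cC {1}cE mul_row_col.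
have NE : N *m E^T = 0 by rewrite -[LHS]trmxK trmx_mul trmxK EN trmx0.
have c00 : lsubmx c 0 0 = dot N N.
  rewrite {1}Ncr dotDl /dot -!mulmxA EN mulmx0 [X in _ + X]mxE addr0.
  by rewrite [RHS]mxE big_ord1 -[(r *m _) 0 0]/(dot r N) dotC Nr mulr1.
have eN : (col_mx N E : 'M[R]_(1 + n)) =
    block_mx (lsubmx c) (rsubmx c) 0 1%:M *m C.
  by rewrite /C mul_block_col -Ncr mul0mx add0r mul1mx.
have dM : \det (col_mx N E : 'M[R]_(1 + n)) = dot N N * \det C.
  rewrite eN det_mulmx det_ublock det1 mulr1.
  by rewrite -c00 [lsubmx c]mx11_scalar det_scalar1 [in RHS]mxE eqxx mulr1n.
(* Since [N] is orthogonal to the rows of [E], this product is block triangular with corner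
   [dot N r = 1]. *)
have : \det ((col_mx N E : 'M[R]_(1 + n)) *m C^T) = \det (E *m E^T).
  rewrite tr_col_mx mul_col_row NE det_lblock.
  by rewrite [N *m r^T]mx11_scalar det_scalar1 -[_ 0 0]/(dot N r) Nr mul1r.
by rewrite det_mulmx det_tr dM => <-; rewrite expr2 mulrA.
Qed.

Definition edges k (s : seq 'rV[R]_k) : 'M[R]_k :=
  \matrix_(i < k) (s`_i.+1 - s`_0).

(** Reordering the points permutes the rows [(1, s_i)] of [aug s], which changes its determinant
    only by a sign; subtracting the first row from the others shows that this determinant is that of
    the edges. *)
Lemma det_edges_perm k (s t : seq 'rV[R]_k) : size s = k.+1 -> perm_eq s t ->
  \det (edges s) ^+ 2 = \det (edges t) ^+ 2.
Proof.
move=> ss st; have ts : size t = k.+1 by rewrite -(perm_size st).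
pose aug (s : seq 'rV[R]_k) : 'M[R]_(1 + k) :=
  \matrix_(i < 1 + k) row_mx 1%:M (s`_i : 'rV[R]_k).
have det_aug r : \det (aug r) = \det (edges r).
  have -> : aug r = block_mx 1%:M 0 (const_mx 1) 1%:M *m
      block_mx (1%:M : 'M[R]_1) (r`_0 : 'rV[R]_k) 0 (edges r).
    rewrite mulmx_block !mul1mx !mulmx1 !mul0mx !addr0.
    apply/row_matrixP => i; rewrite rowK.
    case: (split_ordP i) => j ->.
      by rewrite /block_mx rowKu row_id ord1.
    rewrite /block_mx rowKd; apply/rowP => l; rewrite !mxE.
    case: splitP => l' _; rewrite !mxE ?big_ord1 ?mxE//.
      by rewrite ord1.
    by apply/esym; rewrite mul1r addrC; exact: subrK.
  by rewrite det_mulmx det_lblock det_ublock !det1 !mul1r.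
have [p sp] : exists p : {perm 'I_k.+1}, forall i : 'I_k.+1, s`_i = t`_(p i).
  pose S := Tuple (introT eqP ss); pose T := Tuple (introT eqP ts).
  have /tuple_permP[p Ep] : perm_eq S T by [].
  exists p => i.
  have Ep' : s = [tuple tnth T (p j) | j < k.+1] by exact: Ep.
  by rewrite Ep' -tnth_nth tnth_mktuple (tnth_nth 0).
rewrite -!det_aug.
have -> : aug s = row_perm p (aug t).
  by apply/row_matrixP => i; rewrite rowK; apply/rowP => j; rewrite !mxE sp.
rewrite row_permE det_mulmx det_perm exprMn -exprM.
by rewrite mulnC exprM sqrrN expr1n expr1n mul1r.
Qed.

End Determinants.

(** * Integrals over simplices *)

Section Simplex.
Context {R : realType} {d : nat} (M : mesh R d).
Implicit Types (A : {set node M}) (a b : node M) (v : R^o * 'rV[R]_d).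

Lemma sum_vtx (V : nmodType) A (F : 'rV[R]_d -> V) :
  \sum_(a in A) F (pos a) = \sum_(i < #|A|) F (vtx A i).
Proof.
rewrite -big_enum/= -(big_map (@pos _ _ M) xpredT F) (big_nth 0).
by rewrite size_map -cardE big_mkord.
Qed.

Lemma vtx_pos A i : (i < #|A|)%N -> exists2 a, a \in A & vtx A i = pos a.
Proof.
move=> iA; case/card_gt0P : (leq_ltn_trans (leq0n i) iA) => a0 _.
exists (nth a0 (enum A) i); first by rewrite -mem_enum mem_nth// -cardE.
by rewrite /vtx (nth_map a0)// -cardE.
Qed.

(** The measure of the simplex: Jacobian factor times the measure 1/k! of the reference simplex. *)
Definition simplex_vol (k : nat) A : R :=
  Num.sqrt (\det (edge_mx k A *m (edge_mx k A)^T)) / k`!%:R.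

(** The vertex rule is exact for affine functions: on the reference simplex the integrand has as
    slopes the differences between its values at the other vertices and at vertex 0. *)
Lemma simplex_int_aff_avg k A v : #|A| = k.+1 ->
  simplex_int k A (aff v) = simplex_vol k A * (k.+1%:R^-1 * \sum_(a in A) aff v (pos a)).
Proof.
move=> cA; rewrite /simplex_int /simplex_vol -mulrA; congr (_ * _).
have -> : (fun t : 'rV[R]_k => aff v (vtx A 0 + t *m edge_mx k A)) =
    (fun t => aff v (vtx A 0) + dot (v.2 *m (edge_mx k A)^T) t).
  apply/funext => t; rewrite /aff /dot -addrA; congr (_ + _).
  by rewrite linearD/= mulmxDr mxE trmx_mul mulmxA.
rewrite ref_int_aff// !expr1n sum_vtx cA big_ord_recl/=.
under eq_bigr => i _.
  rewrite (_ : _ 0 i = aff v (vtx A i.+1) - aff v (vtx A 0)); last first.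
    rewrite affB dotE mxE; apply: eq_bigr => j _.
    by rewrite !mxE.
  over.
rewrite sumrB sumr_const card_ord factS natrM.
rewrite -[_ *+ k]mulr_natl -[k.+1%:R]natr1.
have : (k`!%:R : R) != 0 by rewrite pnatr_eq0 -lt0n fact_gt0.
have : (k%:R + 1 : R) != 0 by rewrite natr1 pnatr_eq0.
by move=> h1 h2; field; rewrite h1 h2.
Qed.

Lemma simplex_int_cst k A (c : R) : #|A| = k.+1 ->
  simplex_int k A (fun=> c) = c * simplex_vol k A.
Proof.
move=> cA; have -> : (fun=> c) = aff ((c : R^o), 0 : 'rV[R]_d).
  by apply/funext => x; rewrite /aff dot0l addr0.
rewrite simplex_int_aff_avg// mulrC; congr (_ * _).
rewrite /aff /=; under eq_bigr do rewrite dot0l addr0.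
by rewrite sumr_const cA -[c *+ _]mulr_natl mulrA mulVf ?mul1r// pnatr_eq0.
Qed.

Lemma mean_aff k A v : #|A| = k.+1 -> simplex_vol k A != 0 ->
  mean k A (aff v) = k.+1%:R^-1 * \sum_(a in A) aff v (pos a).
Proof.
move=> cA mA; rewrite /mean simplex_int_aff_avg// simplex_int_cst// mul1r.
by rewrite mulrAC mulfV// mul1r.
Qed.

Definition nondegenerate_cell A := #|A| = d.+1 /\ row_free (edge_mx d A).

(** The edges issuing from the first vertex form a basis. *)
Lemma grad_inj A (x : 'rV[R]_d) : nondegenerate_cell A ->
  (forall a b, a \in A -> b \in A -> dot x (pos a - pos b) = 0) -> x = 0.
Proof.
move=> [cA fA] H.
have E : x *m (edge_mx d A)^T = 0.
  apply/rowP => i; rewrite !mxE.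
  have [a aA Ea] : exists2 a, a \in A & vtx A i.+1 = pos a.
    by apply: vtx_pos; rewrite cA ltnS.
  have [b bA Eb] : exists2 a, a \in A & vtx A 0 = pos a.
    by apply: vtx_pos; rewrite cA.
  rewrite -[RHS](H _ _ aA bA) dotE; apply: eq_bigr => j _.
  by rewrite -Ea -Eb !mxE.
have uE : (edge_mx d A)^T \in unitmx by rewrite unitmx_tr -row_free_unit.
by rewrite -(mulmxK uE x) E mul0mx.
Qed.

(** The gradient solves the linear system of the edge matrix; the value at the first vertex then
    fixes the constant. *)
Lemma interpolation A (psi : node M -> R) : nondegenerate_cell A ->
  exists v : R^o * 'rV[R]_d, forall a, a \in A -> aff v (pos a) = psi a.
Proof.
move=> [cA fA].
have [|a0 _] := @card_gt0P _ A _; first by rewrite cA.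
pose phi i := psi (nth a0 (enum A) i).
pose g : 'rV[R]_d := (invmx (edge_mx d A) *m \col_(i < d) (phi i.+1 - phi 0))^T.
exists ((phi 0 - dot g (vtx A 0) : R^o), g) => a aA.
have Eg (i : 'I_d) : dot g (vtx A i.+1 - vtx A 0) = phi i.+1 - phi 0.
  have : edge_mx d A *m g^T = \col_(i < d) (phi i.+1 - phi 0).
    by rewrite trmxK mulmxA mulmxV ?mul1mx// -row_free_unit.
  move/matrixP/(_ i 0); rewrite [RHS]mxE => <-.
  by rewrite dotC dotE mxE; apply: eq_bigr => j _; rewrite !mxE.
pose k := index a (enum A).
have kA : (k < #|A|)%N by rewrite cardE index_mem mem_enum.
have <- : phi k = psi a by rewrite /phi nth_index ?mem_enum.
have -> : pos a = vtx A k.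
  by rewrite /vtx (nth_map a) ?nth_index ?mem_enum// -cardE.
rewrite /aff /= -addrA [_ + dot _ _]addrC -dotBr.
case: k kA => [|k]; first by rewrite subrr dotC dot0l addr0.
by rewrite cA ltnS => kd; rewrite (Eg (Ordinal kd)) addrC subrK.
Qed.

End Simplex.

(** * Faces and normals of cells *)

Section Cells.
Context {R : realType} {n : nat} {M : mesh R n.+1}.
Context (nd : forall A, A \in cells M -> nondegenerate_cell A).
Implicit Types (T : cell M) (S : side M) (a b c : node M).
Implicit Types (v : R^o * 'rV[R]_n.+1).

Lemma nd_cell T : nondegenerate_cell (sval T). Proof. exact: nd (svalP T). Qed.

Lemma card_cell T : #|sval T| = n.+2. Proof. by case: (nd_cell T). Qed.

Lemma card_side S : #|sval S| = n.+1.
Proof. by case/andP: (svalP S) => /eqP. Qed.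

Lemma in_adj T S : (T \in adj S) = (sval S \subset sval T).
Proof. by rewrite inE. Qed.

Lemma card_face T a : a \in sval T -> #|sval T :\ a| = n.+1.
Proof.
by move=> aT; have := cardsD1 a (sval T); rewrite aT card_cell add1n => -[<-].
Qed.

Lemma adj_opp T S : T \in adj S -> exists2 a, a \in sval T & sval S = sval T :\ a.
Proof.
rewrite in_adj => ST.
have : (0 < #|sval T :\: sval S|)%N.
  by rewrite cardsDS// card_cell card_side subSnn.
case/card_gt0P => a; rewrite finset.in_setD => /andP[aS aT]; exists a => //.
apply/eqP; rewrite eqEcard subsetD1 ST aS/=.
by rewrite (leq_trans (_ : _ <= n.+1)%N)// ?card_side ?card_face.
Qed.

Lemma face_ex T a : a \in sval T -> exists S, sval S = sval T :\ a.
Proof.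
move=> aT; have iS : is_side (sval T :\ a).
  apply/andP; split; first by rewrite card_face.
  by apply/exists_inP; exists (sval T); [exact: (svalP T)|exact: subD1set].
by exists (exist (fun A => is_true (is_side A)) _ iS).
Qed.

(** Faces of a cell correspond bijectively to their opposite vertices, so sums over faces can be
    evaluated with barycentric gradients. *)
Lemma sum_faces (V : nmodType) T (F : side M -> V) (H : node M -> V) :
  (forall a S, a \in sval T -> sval S = sval T :\ a -> F S = H a) ->
  \sum_(S | T \in adj S) F S = \sum_(a in sval T) H a.
Proof.
move=> FH; have : (0 < #|sval T|)%N by rewrite card_cell.
case/card_gt0P => a0 /face_ex[S0 _].
(* [S0] is only the default of [insubd]; at a vertex of [T], [h a] is the opposite face. *)
pose h a : side M := insubd S0 (sval T :\ a).
have hP a : a \in sval T -> sval (h a) = sval T :\ a.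
  rewrite /h; by move=> /face_ex[S <-]; rewrite -[sval S]/(val S) valKd.
rewrite (eq_bigr (fun a => F (h a))); last first.
  by move=> a aT; apply/esym/FH => //; exact: hP.
rewrite -(big_imset (h := h) F)/=; last first.
  move=> a b aT' bT' /(congr1 (fun S : side M => sval S)).
  have [aT bT] : a \in sval T /\ b \in sval T by [].
  rewrite /= !hP// => /setP/(_ a); rewrite !in_setD1 eqxx/= aT andbT.
  by move=> /esym/negbFE/eqP.
apply: eq_bigl => S; apply/idP/imsetP => [/adj_opp[a aT Sa]|[a aT ->]].
  by exists a => //; apply: val_inj; rewrite [RHS]hP.
by rewrite in_adj hP// subD1set.
Qed.

(** The barycentric coordinate of [a] in [T]; [interpolation] shows that the default of [xget] does
    not occur. *)
Definition bary T a : R^o * 'rV[R]_n.+1 :=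
  xget 0 [set v | forall b, b \in sval T -> aff v (pos b) = (b == a)%:R].

Definition bgrad T a : 'rV[R]_n.+1 := grad (bary T a).

Lemma baryE T a b : b \in sval T -> aff (bary T a) (pos b) = (b == a)%:R.
Proof.
move: b; rewrite /bary; case: xgetP => [v _ //|H].
by have [v vP] := interpolation (fun b => (b == a)%:R) (nd_cell T); case: (H v).
Qed.

Lemma dot_bgrad T a b c : b \in sval T -> c \in sval T ->
  dot (bgrad T a) (pos b - pos c) = (b == a)%:R - (c == a)%:R.
Proof. by move=> bT cT; rewrite -affB !baryE. Qed.

(** Both sides have the same product with every difference of vertices, namely the difference of the
    vertex values of [v]. *)
Lemma grad_bary T v :
  grad v = \sum_(a in sval T) aff v (pos a) *: bgrad T a.
Proof.
apply/eqP; rewrite -subr_eq0; apply/eqP.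
apply: (grad_inj (nd_cell T)) => b c bT cT.
rewrite dotBl -affB dot_suml.
under eq_bigr do rewrite dotZl dot_bgrad// mulrBr.
rewrite sumrB (bigD1 b)//= eqxx mulr1 big1 ?addr0; last first.
  by move=> a /andP[_ /negbTE]; rewrite eq_sym => ->; rewrite mulr0.
rewrite (bigD1 c)//= eqxx mulr1 big1 ?addr0; last first.
  by move=> a /andP[_ /negbTE]; rewrite eq_sym => ->; rewrite mulr0.
by rewrite subrr.
Qed.

(** The constant function 1 has gradient 0 and all vertex values 1. *)
Lemma sum_bgrad T : \sum_(a in sval T) bgrad T a = 0.
Proof.
rewrite -[RHS]/(grad (1 : R^o, 0 : 'rV[R]_n.+1)) (grad_bary T).
by apply: eq_bigr => a _; rewrite /aff dot0l addr0 scale1r.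
Qed.

Lemma bgrad_neq0 T a : a \in sval T -> bgrad T a != 0.
Proof.
move=> aT; have : (0 < #|sval T :\ a|)%N.
  by rewrite card_face.
case/card_gt0P => b; rewrite !inE => /andP[ba bT].
apply/eqP => N0; have := dot_bgrad a aT bT.
by rewrite N0 dot0l eqxx (negbTE ba) subr0 => /esym/eqP; rewrite oner_eq0.
Qed.

Lemma dot_bgrad_gt0 T a : a \in sval T -> 0 < dot (bgrad T a) (bgrad T a).
Proof. by move=> aT; rewrite lt_def dot_eq0 bgrad_neq0// dot_ge0. Qed.

Lemma edges_cell T : edge_mx n.+1 (sval T) = edges [seq pos a | a <- enum (sval T)].
Proof. by []. Qed.

Lemma vol_cell T : simplex_vol n.+1 (sval T) =
  Num.sqrt (\det (edge_mx n.+1 (sval T)) ^+ 2) / n.+1`!%:R.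
Proof. by rewrite /simplex_vol det_mulmx det_tr expr2. Qed.

Lemma det_cell_neq0 T : \det (edge_mx n.+1 (sval T)) != 0.
Proof.
by case: (nd_cell T) => _; rewrite row_free_unit unitmxE unitfE.
Qed.

Lemma vol_cell_gt0 T : 0 < simplex_vol n.+1 (sval T).
Proof.
rewrite vol_cell divr_gt0// ?ltr0n ?fact_gt0// sqrtr_gt0.
by rewrite exprn_even_gt0//= det_cell_neq0.
Qed.

(** The height of [T] over [S] is the inverse length of [bgrad T a]. This is [gram_height] with the
    edges of [S], an edge from [S] to [a], and [N] the barycentric gradient. *)
Lemma vol_face T S a : a \in sval T -> sval S = sval T :\ a ->
  simplex_vol n (sval S) = n.+1%:R * simplex_vol n.+1 (sval T) *
    Num.sqrt (dot (bgrad T a) (bgrad T a)).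
Proof.
move=> aT Sa; set A := sval T; set N := bgrad T a.
have cS := card_side S.
case ES : (enum (sval S)) => [|s0 s].
  by move: cS; rewrite cardE ES.
have memS b : b \in sval S = (b == s0) || (b \in s) by rewrite -mem_enum ES inE.
have aS : a \notin sval S by rewrite Sa !inE eqxx.
have ST : {subset sval S <= A} by move=> b; rewrite Sa => /setD1P[].
have s0S : s0 \in sval S by rewrite memS eqxx.
(* In this order the edges from [s0] are first the one to [a], then those of [S], as [gram_height]
   requires; [det_edges_perm] relates it to the enumeration of [T]. *)
pose t := [seq pos b | b <- [:: s0, a & s]].
have uS : uniq (s0 :: s) by rewrite -ES enum_uniq.
have pt : perm_eq [seq pos b | b <- enum A] t.
  apply: perm_map; rewrite perm_sym; apply: uniq_perm; rewrite ?enum_uniq//.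
    rewrite /= inE; move: uS aS => /= /andP[s0s us]; rewrite memS negb_or.
    by move=> /andP[as0 as']; rewrite eq_sym (negbTE as0) s0s as' us.
  move=> b; rewrite mem_enum !inE orbCA -memS Sa in_setD1.
  by have [->|] := eqVneq b a; rewrite ?aT.
have vS i : vtx (sval S) i = (pos s0 :: [seq pos b | b <- s])`_i.
  by rewrite /vtx ES.
pose r : 'rV[R]_(1 + n) := pos a - vtx (sval S) 0.
pose E : 'M[R]_(n, 1 + n) := edge_mx n (sval S).
have EC : (col_mx r E : 'M[R]_(1 + n)) = edges t.
  apply/row_matrixP => i; rewrite rowK.
  case: (split_ordP i) => j ->.
    by rewrite rowKu row_id /r vS ord1.
  by rewrite rowKd rowK !vS.
have dC : \det (col_mx r E : 'M[R]_(1 + n)) ^+ 2 = \det (edge_mx n.+1 A) ^+ 2.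
  rewrite EC edges_cell; apply/esym/det_edges_perm => //.
  by rewrite size_map -cardE card_cell.
have g : \det (E *m E^T) = dot N N * \det (edge_mx n.+1 A) ^+ 2.
  rewrite -dC; apply: gram_height.
  - by rewrite unitmxE unitfE -sqrf_eq0 dC sqrf_eq0 det_cell_neq0.
  - apply/colP => i; rewrite !mxE.
    have [b bS Eb] : exists2 b, b \in sval S & vtx (sval S) i.+1 = pos b.
      by apply: vtx_pos; rewrite cS ltnS.
    have ba : b != a by apply: contraNneq aS => <-.
    have s0a : s0 != a by apply: contraNneq aS => <-.
    transitivity (dot N (pos b - pos s0)); last first.
      by rewrite dot_bgrad ?ST// (negbTE ba) (negbTE s0a) subrr.
    by rewrite dotC dotE; apply: eq_bigr => j _; rewrite !mxE Eb vS.
  - have s0a : s0 != a by apply: contraNneq aS => <-.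
    by rewrite /r vS /= dot_bgrad// ?eqxx ?(negbTE s0a) ?subr0//; exact: ST.
rewrite /simplex_vol -/E g sqrtrM ?dot_ge0// -/A det_mulmx det_tr -expr2.
rewrite factS natrM.
have h1 : (n`!%:R : R) != 0 by rewrite pnatr_eq0 -lt0n fact_gt0.
have h2 : (n.+1%:R : R) != 0 by rewrite pnatr_eq0.
by field; rewrite h1 addrC natr1.
Qed.

Lemma vol_side_gt0 S : 0 < simplex_vol n (sval S).
Proof.
have /andP[_ /exists_inP[A AM SA]] := svalP S.
pose T : cell M := exist (fun A => is_true (A \in cells M)) A AM.
have [|a aT Sa] := @adj_opp T S; first by rewrite in_adj.
rewrite (vol_face aT Sa) mulr_gt0 ?sqrtr_gt0 ?dot_bgrad_gt0//.
by rewrite mulr_gt0 ?vol_cell_gt0.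
Qed.

(** The barycentric coordinate of [a] vanishes on [S] and grows into [T], so its normalized negative
    gradient meets the conditions defining the normal. Conversely, orthogonality to [S] leaves only
    multiples of it, and length and orientation fix the factor. *)
Lemma normal_bgrad T S a : a \in sval T -> sval S = sval T :\ a ->
  normal T S = - (Num.sqrt (dot (bgrad T a) (bgrad T a)))^-1 *: bgrad T a.
Proof.
move=> aT Sa; set N := bgrad T a; set s := Num.sqrt _.
have s0 : 0 < s by rewrite sqrtr_gt0 dot_bgrad_gt0.
have NN : dot N N = s ^+ 2 by rewrite sqr_sqrtr// dot_ge0.
have sT b : b \in sval S -> b \in sval T /\ b != a.
  by rewrite Sa => /setD1P[].
have TS b : b \in sval T :\: sval S -> b = a.
  rewrite Sa !inE => /andP[]; rewrite negb_and negbK => /orP[/eqP//|].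
  by move=> /negbTE ->.
have [b bS] : exists b, b \in sval S.
  by apply/card_gt0P; rewrite card_side.
have [bT ba] := sT _ bS.
apply: xget_unique => [|nu [n1 n2 n3]].
  split.
  - by rewrite dotZl dotZr NN mulrA mulrNN -expr2 -exprMn mulVf ?expr1n// gt_eqF.
  - move=> c e /sT[cT ca] /sT[eT ea].
    by rewrite dotZl dot_bgrad// (negbTE ca) (negbTE ea) subrr mulr0.
  - move=> c e /TS-> /sT[eT ea].
    by rewrite dotZl dot_bgrad// eqxx (negbTE ea) subr0 mulr1 oppr_lt0 invr_gt0.
(* [N] has product 1 with this edge, so [k] must be the factor of [nu] along [N]. *)
pose k := dot nu (pos a - pos b).
have k0 : k < 0 by apply: n3 => //; rewrite Sa !inE eqxx.
have nuk : nu = k *: N.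
  apply/eqP; rewrite -subr_eq0; apply/eqP.
  apply: (grad_inj (nd_cell T)).
  have H c : c \in sval T -> dot (nu - k *: N) (pos c - pos b) = 0.
    move=> cT; rewrite dotBl dotZl dot_bgrad// (negbTE ba) subr0.
    have [->|ca] := eqVneq c a; first by rewrite mulr1 subrr.
    by rewrite mulr0 subr0 n2// Sa !inE ca.
  move=> c e cT eT; rewrite -[pos c](subrK (pos b)) -addrA dotDr H// add0r.
  by rewrite -[pos b - pos e]opprB dotNr H// oppr0.
have /eqP : (k * s) ^+ 2 = 1.
  by move: n1; rewrite nuk dotZl dotZr NN mulrA -expr2 -exprMn.
rewrite sqrf_eq1 => /orP[] /eqP ks.
  by move: (nmulr_rlt0 s k0); rewrite ks s0 ltr10.
by rewrite nuk -[k](mulfK (lt0r_neq0 s0)) ks mulN1r.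
Qed.

(** In the product of measure and normal the square roots cancel; this is the form that integration
    by parts uses. *)
Lemma vol_normal T S a : a \in sval T -> sval S = sval T :\ a ->
  simplex_vol n (sval S) *: normal T S =
    - (n.+1%:R * simplex_vol n.+1 (sval T)) *: bgrad T a.
Proof.
move=> aT Sa; rewrite (vol_face aT Sa) (normal_bgrad aT Sa) scalerA.
rewrite mulrN mulfK// gt_eqF// sqrtr_gt0.
exact: dot_bgrad_gt0.
Qed.

End Cells.

(** * Integration by parts and surjectivity of pi_h *)

Section Fields.
Context {R : realType} {n : nat} {M : mesh R n.+1}.
Context (nd : forall A, A \in cells M -> nondegenerate_cell A).
Implicit Types (T : cell M) (S : side M) (a b c : node M).
Implicit Types (v : CR M) (y : L1d M) (p : L0d M) (B : {set side M}).

Definition cell_vol T : R := simplex_vol n.+1 (sval T).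
Definition side_vol S : R := simplex_vol n (sval S).

Lemma cell_vol_gt0 T : 0 < cell_vol T. Proof. exact: vol_cell_gt0. Qed.

Lemma side_vol_gt0 S : 0 < side_vol S. Proof. exact: vol_side_gt0. Qed.

Lemma domain_int_cst (F : cell M -> R) :
  domain_int (fun T _ => F T) = \sum_T F T * cell_vol T.
Proof. by apply: eq_bigr => T _; rewrite /cell_int simplex_int_cst// card_cell. Qed.

Lemma sides_int_cst B (F : side M -> R) :
  sides_int B (fun S _ => F S) = \sum_(S in B) F S * side_vol S.
Proof. by apply: eq_bigr => S _; rewrite /side_int simplex_int_cst// card_side. Qed.

Definition barycenter T : 'rV[R]_n.+1 := n.+2%:R^-1 *: \sum_(a in sval T) pos a.

Lemma mean_cell T (w : R^o * 'rV[R]_n.+1) :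
  mean n.+1 (sval T) (aff w) = aff w (barycenter T).
Proof.
by rewrite mean_aff ?card_cell ?gt_eqF ?vol_cell_gt0// (aff_center _ _ (card_cell nd T)).
Qed.

Lemma mean_side S (w : R^o * 'rV[R]_n.+1) :
  mean n (sval S) (aff w) = n.+1%:R^-1 * \sum_(a in sval S) aff w (pos a).
Proof. by rewrite mean_aff ?card_side ?gt_eqF ?vol_side_gt0. Qed.

Lemma vaff_coord (w : 'rV[R]_n.+1 * 'M[R]_n.+1) i :
  (fun x => vaff w x 0 i) = aff (w.1 0 i : R^o, (col i w.2)^T).
Proof.
apply/funext => x; rewrite /aff /vaff /= !mxE dotE; congr (_ + _).
by apply: eq_bigr => j _; rewrite !mxE mulrC.
Qed.

Lemma Pi_vec_hE (y : RT M) T : Pi_vec_h y T = vaff (sval y T) (barycenter T).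
Proof. by apply/rowP => i; rewrite mxE vaff_coord mean_cell -vaff_coord. Qed.

Lemma adj_gt0 S : (0 < #|adj S|)%N.
Proof.
have /andP[_ /exists_inP[A AM SA]] := svalP S.
apply/card_gt0P; exists (exist (fun A => is_true (A \in cells M)) A AM).
by rewrite in_adj.
Qed.

(** The jump condition equates the means of the traces from all cells at [S], so their average is
    any one of them. *)
Lemma pi_h_mean v S T : T \in adj S -> mean n (sval S) (aff (sval v T)) = pi_h v S.
Proof.
move=> TS; have H T' : T' \in adj S ->
    mean n (sval S) (aff (sval v T')) = mean n (sval S) (aff (sval v T)).
  move=> T'S; have [->//|TT'] := eqVneq T' T.
  have iS : interior_side S.
    rewrite /interior_side (cardD1 T) TS (cardD1 T') !inE TT'.
    by move: T'S; rewrite inE => ->.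
  have /forallP/(_ S)/forallP/(_ T')/forallP/(_ T) := svalP v.
  rewrite iS TS T'S/= => /eqP; rewrite /side_int simplex_int_aff_avg ?card_side//.
  move/eqP; rewrite mulf_eq0 (gt_eqF (vol_side_gt0 nd S))/= mulf_eq0.
  rewrite invr_eq0 pnatr_eq0/= => /eqP E.
  apply/eqP; rewrite !mean_side -subr_eq0 -mulrBr -sumrB; apply/eqP.
  rewrite -[RHS](mulr0 n.+1%:R^-1); congr (_ * _); rewrite -[RHS]E.
  apply: eq_bigr => a _; rewrite /aff /= dotBl; ring.
rewrite /pi_h (eq_bigr _ H) sumr_const -[_ *+ _]mulr_natl mulrAC mulfV ?mul1r//.
by rewrite pnatr_eq0 -lt0n adj_gt0.
Qed.

(* On the face opposite to [a], the affine function with vertex values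
   [\sum_b h b - (n + 1) h c] at [c] has mean [h a]. *)
Lemma pi_h_surj (w : side M -> R) : exists v, pi_h v = w.
Proof.
have ex T : exists v : R^o * 'rV[R]_n.+1, forall S, T \in adj S ->
    n.+1%:R^-1 * \sum_(a in sval S) aff v (pos a) = w S.
  (* For a vertex [a] of [T] only the face opposite to [a] contributes; the sum makes [h] a total
     function. *)
  pose h a := \sum_(S | sval S == sval T :\ a) w S.
  have [v vP] := interpolation
    (fun a => \sum_(b in sval T) h b - n.+1%:R * h a) (nd (svalP T)).
  exists v => S /(adj_opp nd)[a aT Sa].
  have hS : h a = w S.
    by rewrite /h (big_pred1 S)// => S'; rewrite -Sa.
  have ST b : b \in sval S -> b \in sval T by rewrite Sa => /setD1P[].
  under eq_bigr => b bS do rewrite vP ?ST//.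
  rewrite sumrB sumr_const card_side -mulr_sumr -hS.
  rewrite -[(\sum_(b in sval T) h b) *+ _]mulr_natl -mulrBr.
  rewrite [\sum_(b in sval T) h b](bigD1 a)//=.
  rewrite (eq_bigl (fun b => b \in sval S)); last first.
    by move=> b; rewrite Sa in_setD1 andbC.
  rewrite addrK mulrA mulVf ?mul1r//.
have [V VP] := choice ex.
have cV : cr_pred (V : L1 M).
  apply/forallP => S; apply/forallP => T; apply/forallP => T'.
  apply/implyP => /and3P[_ TS T'S]; rewrite /side_int.
  rewrite simplex_int_aff_avg ?card_side//; apply/eqP.
  rewrite -[RHS](mulr0 (simplex_vol n (sval S))); congr (_ * _).
  rewrite (eq_bigr (fun a => aff (V T) (pos a) - aff (V T') (pos a))).
    by rewrite sumrB mulrBr !VP// subrr.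
  by move=> a _; rewrite /aff/= dotBl; ring.
exists (exist (fun x => is_true (cr_pred x)) (V : L1 M) cV); apply/funext => S.
have /card_gt0P[T TS] := adj_gt0 S.
by rewrite -(pi_h_mean _ TS) mean_side VP.
Qed.

(** The local shape of Raviart-Thomas fields: the linear part is a multiple of the identity, with
    the factor forced by the trace. Normal jumps are still allowed. *)
Definition radial y := forall T, (y T).2 = (divergence (y T) / n.+1%:R)%:M.

(* By [sum_bgrad], an affine field whose normal component is constant on each
   face takes, in the direction of the barycentric gradient of [a], a value
   [al a] at the vertices other than [a] and [al a - \sum_b al b] at [a]. *)
Lemma is_rt_radial y : is_rt y -> radial y.
Proof.
move=> [yc _] T.
have H a : exists al : R, forall b, b \in sval T -> b != a ->
    a \in sval T -> dot (vaff (y T) (pos b)) (bgrad T a) = al.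
  case aT : (a \in sval T); last by exists 0.
  have [S Sa] := face_ex nd aT.
  have [|al alP] := yc S T; first by rewrite in_adj Sa subD1set.
  exists (- Num.sqrt (dot (bgrad T a) (bgrad T a)) * al) => b bT ba _.
  rewrite -(alP (pos b)).
    rewrite (normal_bgrad nd aT Sa) dotZr mulrA mulrNN mulfV ?mul1r// gt_eqF//.
    by rewrite sqrtr_gt0 dot_bgrad_gt0.
  have bS : b \in sval S by rewrite Sa in_setD1 ba.
  exists (fun c => (c == b)%:R); split.
  - by move=> c _; rewrite ler0n.
  - rewrite (bigD1 b)//= eqxx big1 ?addr0// => c /andP[_ /negbTE->//].
  - rewrite (bigD1 b)//= eqxx scale1r big1 ?addr0// => c /andP[_ /negbTE->].
    by rewrite scale0r.
have [al alP] := choice H.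
pose k := - \sum_(a in sval T) al a.
have E a b : a \in sval T -> b \in sval T ->
    dot (vaff (y T) (pos b)) (bgrad T a) = al a + (b == a)%:R * k.
  move=> aT bT; have [<-|ba] := eqVneq b a; last by rewrite mul0r addr0 alP.
  have := congr1 (dot (vaff (y T) (pos b))) (sum_bgrad nd T).
  rewrite [RHS]dotC dot0l dotC dot_suml (bigD1 b)//= => /eqP.
  rewrite addr_eq0 dotC => /eqP ->.
  rewrite mul1r /k [in RHS](bigD1 b)//= opprD addrA subrr add0r; congr (- _).
  by apply: eq_bigr => c /andP[cT cb]; rewrite dotC alP// eq_sym.
have yk : (y T).2 = k%:M.
  apply/eqP; rewrite -subr_eq0; apply/eqP.
  apply/matrixP => i j; rewrite [RHS]mxE.
  suff : (col j ((y T).2 - k%:M))^T = 0.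
    by move=> /rowP/(_ i); rewrite [RHS]mxE => <-; rewrite !mxE.
  apply: (grad_inj (nd_cell nd T)) => b c bT cT.
  set D := (y T).2 - k%:M.
  suff xD : (pos b - pos c) *m D = 0.
    move/rowP/(_ j): xD; rewrite [RHS]mxE => <-; rewrite dotC dotE mxE.
    by apply: eq_bigr => l _; rewrite !mxE.
  set x := _ *m D.
  (* Barycentric gradients span: [grad_bary] for the linear function with gradient [x] then gives
     [dot x x = 0]. *)
  have xN a : a \in sval T -> dot (bgrad T a) x = 0.
    move=> aT; rewrite /x /D mulmxBr dotBr mul_mx_scalar dotZr dot_bgrad//.
    have := E a b aT bT; have := E a c aT cT; rewrite /vaff !dotDl => Ec Eb.
    rewrite dotC mulmxBl dotBl.
    have -> : dot (pos b *m (y T).2) (bgrad T a) =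
      al a + (b == a)%:R * k - dot (y T).1 (bgrad T a) by rewrite -Eb; ring.
    have -> : dot (pos c *m (y T).2) (bgrad T a) =
      al a + (c == a)%:R * k - dot (y T).1 (bgrad T a) by rewrite -Ec; ring.
    by ring.
  apply/eqP; rewrite -dot_eq0; apply/eqP.
  rewrite {1}[x](grad_bary nd T (0 : R^o, x)) dot_suml big1// => a aT.
  by rewrite dotZl xN// mulr0.
by rewrite /divergence yk mxtrace_scalar -[k *+ _]mulr_natr mulfK// pnatr_eq0.
Qed.

Lemma dot_normal T S a b : T \in adj S -> a \in sval S -> b \in sval S ->
  dot (normal T S) (pos a - pos b) = 0.
Proof.
move=> /(adj_opp nd)[c cT Sc] aS bS; rewrite (normal_bgrad nd cT Sc) dotZl.
move: aS bS; rewrite Sc => /setD1P[/negbTE ac aT] /setD1P[/negbTE bc bT].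
by rewrite dot_bgrad// ac bc subrr mulr0.
Qed.

Lemma vtx0_side S : exists2 b, b \in sval S & vtx (sval S) 0 = pos b.
Proof. by apply: vtx_pos; rewrite card_side. Qed.

Lemma pos_hull (A : {set node M}) b : b \in A -> hull A (pos b).
Proof.
move=> bA; exists (fun c => (c == b)%:R); split.
- by move=> c _; rewrite ler0n.
- by rewrite (bigD1 b)//= eqxx big1 ?addr0// => c /andP[_ /negbTE->].
- rewrite (bigD1 b)//= eqxx scale1r big1 ?addr0// => c /andP[_ /negbTE->].
  by rewrite scale0r.
Qed.

(** The normal component depends on [x] only through its product with the normal, which is constant
    on a side. *)
Lemma radial_dot_normal y T S x : radial y -> T \in adj S -> hull (sval S) x ->
  dot (vaff (y T) x) (normal T S) = dot (vaff (y T) (vtx (sval S) 0)) (normal T S).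
Proof.
move=> ry TS [w [_ w1 ->]]; have [b bS ->] := vtx0_side S.
rewrite /vaff ry !mul_mx_scalar !dotDl !dotZl; congr (_ + _ * _).
apply/eqP; rewrite -subr_eq0 -dotBl.
rewrite -[pos b]scale1r -w1 scaler_suml -sumrB dot_suml big1// => a aS.
by rewrite -scalerBr dotZl dotC dot_normal// mulr0.
Qed.

(** Sampled at one vertex; by [radial_trace] this is the constant value on the side when [y] is
    radial. *)
Definition side_trace y S : R := normal_trace y S (vtx (sval S) 0).

Lemma radial_trace y S x : radial y -> hull (sval S) x ->
  normal_trace y S x = side_trace y S.
Proof.
move=> ry Sx; apply: eq_bigr => T TS.
exact: radial_dot_normal.
Qed.

(** The integrand lives on the whole space and is constant only on the side; writing it as an affine
    function lets the vertex rule see just its vertex values. *)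
Lemma sides_int_trace y B (w : side M -> R) : radial y ->
  sides_int B (fun S x => normal_trace y S x * w S) =
  \sum_(S in B) side_trace y S * w S * side_vol S.
Proof.
move=> ry; apply: eq_bigr => S _; rewrite /side_int.
pose al : R := \sum_(T in adj S) dot (y T).1 (normal T S) * w S.
pose be := \sum_(T in adj S) (divergence (y T) / n.+1%:R * w S) *: normal T S.
have E : (fun x => normal_trace y S x * w S) = aff (al : R^o, be).
  apply/funext => x; rewrite /aff /= dot_suml -big_split mulr_suml.
  apply: eq_bigr => T TS; rewrite /vaff ry mul_mx_scalar dotDl !dotZl.
  by rewrite (dotC x) mulrDl mulrAC.
rewrite E simplex_int_aff_avg ?card_side// -E.
rewrite (eq_bigr (fun=> side_trace y S * w S)); last first.
  by move=> a aS; rewrite radial_trace//; exact: pos_hull.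
rewrite sumr_const card_side -[(side_trace y S * w S) *+ _]mulr_natl.
by rewrite [n.+1%:R^-1 * _]mulrA mulVf ?mul1r ?pnatr_eq0// mulrC.
Qed.

(** The divergence theorem on one cell, proved algebraically: [vol_normal] turns the sum over faces
    into a sum over vertices, which [sum_bgrad] and [grad_bary] evaluate. *)
Lemma cell_parts y T (w : R^o * 'rV[R]_n.+1) : radial y ->
  (dot (vaff (y T) (barycenter T)) (grad w) +
    divergence (y T) * mean n.+1 (sval T) (aff w)) * cell_vol T =
  \sum_(S | T \in adj S) side_vol S *
     dot (vaff (y T) (vtx (sval S) 0)) (normal T S) * mean n (sval S) (aff w).
Proof.
move=> ry; set k := divergence (y T) / n.+1%:R; set q := vaff _ (barycenter T).
have k0 : divergence (y T) = n.+1%:R * k by rewrite mulrC divfK// pnatr_eq0.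
set W := \sum_(a in sval T) aff w (pos a).
have mT : mean n.+1 (sval T) (aff w) = n.+2%:R^-1 * W.
  by rewrite mean_aff ?card_cell ?gt_eqF ?vol_cell_gt0.
(* The coordinate of [a] is 0 on the opposite face and 1/(n+2) at the barycenter, whence the shift
   by [k / n.+2%:R]. The factor n+1 of [vol_normal] cancels against the mean over the n+1 face
   vertices. *)
rewrite (sum_faces nd (H := fun a => - (cell_vol T *
    (dot q (bgrad T a) - k / n.+2%:R)) * (W - aff w (pos a)))); last first.
  move=> a S aT Sa.
  have [b bS ->] := vtx0_side S.
  have mS : mean n (sval S) (aff w) = n.+1%:R^-1 * (W - aff w (pos a)).
    rewrite mean_side /W [in RHS](bigD1 a)//= addrAC subrr add0r.
    congr (_ * _); apply: eq_bigl => c; by rewrite Sa in_setD1 andbC.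
  have -> : side_vol S * dot (vaff (y T) (pos b)) (normal T S) =
    dot (vaff (y T) (pos b)) (side_vol S *: normal T S) by rewrite dotZr.
  rewrite (vol_normal nd aT Sa) dotZr mS.
  have -> : dot (vaff (y T) (pos b)) (bgrad T a) = dot q (bgrad T a) - k / n.+2%:R.
    have := affB (bary T a) (pos b) (barycenter T).
    move: bS; rewrite Sa => /setD1P[/negbTE ba bT].
    rewrite baryE// ba sub0r (aff_center _ _ (card_cell nd T)).
    rewrite (bigD1 a)//= baryE// eqxx big1 ?addr0 ?mulr1; last first.
      by move=> c /andP[cT /negbTE ca]; rewrite baryE// ca.
    rewrite dotBr -!(dotC _ (bary T a).2) -[(bary T a).2]/(bgrad T a) => H.
    rewrite /q /vaff ry !mul_mx_scalar !dotDl !dotZl -/k.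
    have -> : dot (pos b) (bgrad T a) = dot (barycenter T) (bgrad T a) - n.+2%:R^-1.
      by rewrite H; ring.
    by rewrite {1}/barycenter dotZl mulrBr addrA.
  rewrite -/(cell_vol T) [LHS]mulrA; congr (_ * _).
  rewrite mulrAC !mulNr; congr (- _).
  by rewrite [n.+1%:R * _]mulrC mulfK ?pnatr_eq0.
rewrite (eq_bigr (fun a => cell_vol T * (aff w (pos a) * dot q (bgrad T a)
     - W * dot q (bgrad T a) + k / n.+2%:R * (W - aff w (pos a))))); last first.
  by move=> a _; move: (k / n.+2%:R) (cell_vol T) => z V; ring.
rewrite -mulr_sumr [LHS]mulrC; congr (_ * _).
(* The three sums are [dot q (grad w)], 0, and k/(n+2) times (n+2)W - W, which is the divergence
   times the mean. *)
rewrite big_split/= sumrB -!mulr_sumr sumrB -/W sumr_const card_cell//.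
have -> : \sum_(a in sval T) dot q (bgrad T a) = 0.
  under eq_bigr do rewrite dotC.
  by rewrite -dot_suml sum_bgrad// dot0l.
have -> : \sum_(a in sval T) aff w (pos a) * dot q (bgrad T a) = dot q (grad w).
  rewrite (grad_bary nd T w) dotC dot_suml.
  by apply: eq_bigr => a _; rewrite dotZl dotC.
rewrite mT k0 -[W *+ _]mulr_natl -[n.+2%:R]natr1.
have : (n.+1%:R + 1 : R) != 0 by rewrite natr1 pnatr_eq0.
by move=> h; field.
Qed.

(** Exchanging the sums collects at each side the normal components from its cells; they share the
    factor [pi_h v S] by [pi_h_mean]. *)
Lemma domain_parts y v : radial y ->
  \sum_T (dot (vaff (y T) (barycenter T)) (grad_h v T) +
    divergence (y T) * Pi_h v T) * cell_vol T =
  \sum_S side_trace y S * pi_h v S * side_vol S.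
Proof.
move=> ry; under eq_bigr do rewrite cell_parts//.
rewrite (exchange_big_dep predT)//=; apply: eq_bigr => S _.
rewrite /side_trace /normal_trace !mulr_suml; apply: eq_bigr => T TS.
by rewrite pi_h_mean//; ring.
Qed.

(** As the trace is constant on each side, the supremum is a maximum over finitely many sides, or
    the supremum 0 of the empty set if [B] is empty. *)
Lemma linf_normP B (y : RT M) : radial (sval y) ->
  [/\ 0 <= linf_norm B y,
      forall S, S \in B -> `|side_trace (sval y) S| <= linf_norm B y
    & linf_norm B y = 0 \/
      exists2 S, S \in B & linf_norm B y = `|side_trace (sval y) S|].
Proof.
move=> ry; have [->|[S0 S0B]] := set_0Vmem B.
  suff -> : linf_norm finset.set0 y = 0.
    by split => // [S|]; [rewrite finset.in_set0|left].
  rewrite /linf_norm (_ : mkset _ = set0) ?sup0//.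
  by apply/seteqP; split => // r [S [x []]]; rewrite finset.in_set0.
pose F S := `|side_trace (sval y) S|.
have [S SB Smax] := @arg_maxP _ R _ S0 (mem B) F S0B.
suff E : linf_norm B y = F S.
  by rewrite E; split; [exact: normr_ge0|exact: Smax|right; exists S].
have [b bS _] := vtx0_side S.
apply/eqP; rewrite eq_le; apply/andP; split.
  apply: ge_sup.
    exists (F S), S, (pos b); split => //; first exact: pos_hull.
    by rewrite radial_trace//; exact: pos_hull.
  move=> r [S' [x [S'B S'x ->]]]; rewrite radial_trace//; exact: Smax.
apply: ub_le_sup.
  exists (F S) => r [S' [x [S'B S'x ->]]]; rewrite radial_trace//; exact: Smax.
exists S, (pos b); split => //; first exact: pos_hull.
by rewrite radial_trace//; exact: pos_hull.
Qed.

End Fields.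

(** * Duality *)

Lemma affine_bounded (R : realFieldType) (a b r : R) :
  (forall t, a + t * b <= r) -> b = 0.
Proof.
move=> H; apply/eqP/negPn/negP => b0.
(* At this point the affine function equals [r + 1]. *)
by have := H ((r - a + 1) / b); rewrite mulfVK//; lra.
Qed.

(** A first variation argument: divide by [t] and let [t] tend to 0. *)
Lemma quad_nonneg (R : realFieldType) (a b : R) :
  (forall t, 0 < t < 1 -> 0 <= t * a + t ^+ 2 * b) -> 0 <= a.
Proof.
move=> H; rewrite leNgt; apply/negP => a0.
(* If [a] were negative, this choice would give [t * b <= - a / 2], hence [a + t * b < 0]. *)
pose t := Num.min 2^-1 (- a / (2 * (`|b| + 1))).
have b1 : 0 < `|b| + 1 by rewrite ltr_wpDl.
have t0 : 0 < t.
  by rewrite lt_min invr_gt0 ltr0n/= divr_gt0 ?oppr_gt0// mulr_gt0.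
have t1 : t < 1 by rewrite gt_min invf_lt1 ?ltr1n.
have tb : t * (`|b| + 1) <= - a / 2.
  have -> : - a / 2 = - a / (2 * (`|b| + 1)) * (`|b| + 1) by field; rewrite gt_eqF.
  by rewrite ler_pM2r// ge_min lexx orbT.
have := H t; rewrite t0 t1 => /(_ isT); rewrite expr2 -mulrA -mulrDr.
rewrite pmulr_rge0// leNgt => /negP; apply.
have : t * b <= t * (`|b| + 1).
  by rewrite ler_pM2l//; have := ler_norm b; lra.
lra.
Qed.

(** * The inner product of element-wise constant fields and the conjugate of [G_h] *)

Section L2.
Context {R : realType} {n : nat} {M : mesh R n.+1}.
Context (nd : forall A, A \in cells M -> nondegenerate_cell A).
Implicit Types p q : L0d M.

Lemma l2_dotE p q : l2_dot p q = \sum_T dot (p T) (q T) * cell_vol T.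
Proof. exact: domain_int_cst nd _. Qed.

Lemma l2_dotC p q : l2_dot p q = l2_dot q p.
Proof. by rewrite !l2_dotE; apply: eq_bigr => T _; rewrite dotC. Qed.

Lemma l2_dot_linear (a : R) p q r : l2_dot p (a *: q + r) = a * l2_dot p q + l2_dot p r.
Proof.
rewrite !l2_dotE mulr_sumr -big_split; apply: eq_bigr => T _ /=.
by rewrite (_ : (a *: q + r) T = a *: q T + r T)// dotDr dotZr; ring.
Qed.

Lemma l2_dotD p q r : l2_dot p (q + r) = l2_dot p q + l2_dot p r.
Proof. by rewrite -[q]scale1r l2_dot_linear scale1r mul1r. Qed.

Lemma l2_dotZ (a : R) p q : l2_dot p (a *: q) = a * l2_dot p q.
Proof.
rewrite -[a *: q]addr0 l2_dot_linear [X in _ + X](_ : _ = 0) ?addr0//.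
by rewrite l2_dotE big1// => T _; rewrite dotC dot0l mul0r.
Qed.

Lemma l2_dotB p q r : l2_dot p (q - r) = l2_dot p q - l2_dot p r.
Proof. by rewrite l2_dotD -scaleN1r l2_dotZ mulN1r. Qed.

Lemma l2_dot_ge0 p : 0 <= l2_dot p p.
Proof.
by rewrite l2_dotE sumr_ge0// => T _; rewrite mulr_ge0 ?dot_ge0 ?ltW ?cell_vol_gt0.
Qed.

Lemma l2_dot_eq0 p : l2_dot p p = 0 -> p = 0.
Proof.
rewrite l2_dotE => /psumr_eq0P H; apply/funext => T; apply/eqP.
rewrite -dot_eq0 -(mulIr_eq0 _ (mulIf (lt0r_neq0 (cell_vol_gt0 nd T)))) H// => T' _.
by rewrite mulr_ge0 ?dot_ge0 ?ltW ?cell_vol_gt0.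
Qed.

Lemma l2_sqrD p q : l2_dot (p + q) (p + q) = l2_dot p p + 2 * l2_dot p q + l2_dot q q.
Proof. by rewrite l2_dotD !(l2_dotC (p + q)) !l2_dotD (l2_dotC q p); ring. Qed.

Lemma l2_sqrB p q : l2_dot (p - q) (p - q) = l2_dot p p - 2 * l2_dot p q + l2_dot q q.
Proof. by rewrite l2_dotB !(l2_dotC (p - q)) !l2_dotB (l2_dotC q p); ring. Qed.

(** Completing the square; the supremum is attained at [p] itself. *)
Lemma conjugate_G_h p : conjugate (@G_h R n M) (l2_dot p) = (2^-1 * l2_dot p p)%:E.
Proof.
apply/eqP; rewrite eq_le; apply/andP; split.
  apply: ge_ereal_sup => _ [q _ <-]; rewrite /G_h -EFinB lee_fin.
  by have := l2_dot_ge0 (p - q); rewrite l2_sqrB; lra.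
apply: ereal_sup_ubound; exists p => //; rewrite /G_h -EFinB.
by congr (_%:E); lra.
Qed.

End L2.

(** * The conjugate of [F_h] and the dual functional *)

Section Duality.
Context {R : realType} {n : nat} {M : mesh R n.+1}.
Context (nd : forall A, A \in cells M -> nondegenerate_cell A).
Context (GI GD GN : set 'rV[R]_n.+1) (hs : compatible_sides M GI GD GN).
Context (m : R) (hm : 0 < m) (f : cell M -> R) (g uD : side M -> R).
Implicit Types (T : cell M) (S : side M) (v : CR M) (y : RT M) (p : L0d M).
Implicit Types (w : side M -> R).

Let SI := sides_in M GI.
Let SD := sides_in M GD.
Let SN := sides_in M GN.
Let K := @K_cr R n M GD uD.
Let Fr := F_real GI GN m f g (M := M).
Let F := F_h GI GD GN m f g uD.
Let adm := rt_admissible GN f g.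
Let D := D_rt GI GD GN m f g uD.
Let Ic := I_cr GI GD GN m f g uD.

Lemma sum_sides (X : side M -> R) :
  \sum_S X S = \sum_(S | interior_side S) X S + \sum_(S in SI) X S +
    \sum_(S in SD) X S + \sum_(S in SN) X S.
Proof.
have [hb ID IN DN] := hs.
rewrite (big_mkcond (fun S => interior_side S)) (big_mkcond (fun S => S \in SI)).
rewrite (big_mkcond (fun S => S \in SD)) (big_mkcond (fun S => S \in SN)) -!big_split.
apply: eq_bigr => S _ /=.
move/setP/(_ S): hb; rewrite !finset.in_setU [LHS]inE -/SI -/SD -/SN => hb.
move/setP/(_ S): ID; move/setP/(_ S): IN; move/setP/(_ S): DN.
rewrite !finset.in_setI !finset.in_set0 -/SI -/SD -/SN => DN IN ID.
move: hb DN IN ID; case: (interior_side S); case: (S \in SI);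
  case: (S \in SD); case: (S \in SN) => //=; by rewrite ?addr0 ?add0r.
Qed.

Lemma F_realE v : Fr v =
  (2 * m)^-1 * (\sum_(S in SI) `|pi_h v S| * side_vol S) ^+ 2
  - \sum_T f T * Pi_h v T * cell_vol T - \sum_(S in SN) g S * pi_h v S * side_vol S.
Proof. by rewrite /Fr /F_real /l1_norm !sides_int_cst// domain_int_cst. Qed.

(** The integrand of the conjugate as a function of the side means [w], with [nu] the normal traces
    and jumps of a field. *)
Let Psi (nu w : side M -> R) : R :=
  \sum_(S in SN) g S * w S * side_vol S - \sum_S nu S * w S * side_vol S
  - (2 * m)^-1 * (\sum_(S in SI) `|w S| * side_vol S) ^+ 2.

(** In [domain_parts] the divergence condition cancels the load [f]. Normal jumps of [y] are
    permitted, so this applies before [y] is known to be Raviart-Thomas. *)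
Lemma dual_integrand (y : L1d M) p v : radial y ->
  (forall T, divergence (y T) = - f T) ->
  (forall T, vaff (y T) (barycenter T) = p T) ->
  - l2_dot p (grad_h v) - Fr v = Psi (side_trace y) (pi_h v).
Proof.
move=> ry yf yp; rewrite /Psi -(domain_parts nd v ry) F_realE l2_dotE//.
under [X in _ = _ - X - _]eq_bigr do rewrite yf yp mulrDl mulNr mulNr.
by rewrite big_split/= sumrN; ring.
Qed.

(** The radial field x |-> p - f/(n+1) (x - x_T), the only one with barycenter values [p] and
    divergence [- f]. *)
Definition field_of p : L1d M :=
  fun T => (p T + (f T / n.+1%:R) *: barycenter T, (- (f T / n.+1%:R))%:M).

Lemma divergence_field_of p T : divergence (field_of p T) = - f T.
Proof.
by rewrite /divergence mxtrace_scalar -[_ *+ _]mulr_natr mulNr divfK// pnatr_eq0.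
Qed.

Lemma radial_field_of p : radial (field_of p).
Proof. by move=> T; rewrite divergence_field_of mulNr. Qed.

Lemma field_of_center p T : vaff (field_of p T) (barycenter T) = p T.
Proof. by rewrite /vaff mul_mx_scalar scaleNr/= addrK. Qed.

Lemma RT_radial y : radial (sval y).
Proof. by apply: is_rt_radial nd _ _; apply/asboolP; exact: (svalP y). Qed.

(* Varying the mean on a single interior or Neumann side is admissible, leaves
   the norm on GI unchanged, and changes the functional linearly. *)
Lemma bounded_admissible p (v0 : CR M) r : K v0 ->
  (forall v, K v -> - l2_dot p (grad_h v) - Fr v <= r) ->
  exists y, adm y /\ Pi_vec_h y = p.
Proof.
move=> Kv0 vr; set y := field_of p; set nu := side_trace y.
have ry : radial y := radial_field_of p.
(* Both conditions at once: trace [g] on Neumann sides, no normal jump on interior sides. *)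
have H S0 : S0 \notin SI -> S0 \notin SD -> nu S0 = if S0 \in SN then g S0 else 0.
  move=> S0I S0D.
  suff : ((if S0 \in SN then g S0 else 0) - nu S0) * side_vol S0 = 0.
    move/eqP; rewrite mulf_eq0 (gt_eqF (side_vol_gt0 nd S0)) orbF subr_eq0.
    by move/eqP.
  apply: (@affine_bounded _ (Psi nu (pi_h v0)) _ r) => t.
  pose w S := pi_h v0 S + (if S == S0 then t else 0).
  have [v vw] := pi_h_surj nd w.
  have Kv : K v.
    move=> S SD'; rewrite vw /w; case: eqP => [SS|_]; last by rewrite addr0 Kv0.
    by move: S0D; rewrite -SS SD'.
  have := vr v Kv.
  rewrite (dual_integrand v ry (divergence_field_of p) (field_of_center p)) vw.
  rewrite -/nu; apply: le_trans; rewrite le_eqVlt; apply/orP; left; apply/eqP.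
  rewrite /Psi.
  have -> : \sum_(S in SI) `|w S| * side_vol S =
      \sum_(S in SI) `|pi_h v0 S| * side_vol S.
    apply: eq_bigr => S SI'; rewrite /w; case: eqP => [SS|]; last by rewrite addr0.
    by move: S0I; rewrite -SS SI'.
  have -> : \sum_S nu S * w S * side_vol S =
      \sum_S nu S * pi_h v0 S * side_vol S + t * nu S0 * side_vol S0.
    rewrite (bigD1 S0)//= [in RHS](bigD1 S0)//= /w eqxx.
    rewrite (eq_bigr (fun S => nu S * pi_h v0 S * side_vol S)); first by ring.
    by move=> S /negbTE ->; rewrite addr0.
  have -> : \sum_(S in SN) g S * w S * side_vol S =
      \sum_(S in SN) g S * pi_h v0 S * side_vol S +
      t * (if S0 \in SN then g S0 else 0) * side_vol S0.
    have [S0N|S0N] := boolP (S0 \in SN).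
      rewrite (bigD1 S0)//= [in RHS](bigD1 S0)//= /w eqxx.
      rewrite (eq_bigr (fun S => g S * pi_h v0 S * side_vol S)); first by ring.
      by move=> S /andP[_ /negbTE ->]; rewrite addr0.
    rewrite mulr0 mul0r addr0; apply: eq_bigr => S SN'; rewrite /w.
    case: eqP => [SS|]; last by rewrite addr0.
    by move: S0N; rewrite -SS SN'.
  by ring.
have [hb ID IN DN] := hs.
have bdry S : (S \in SI) || (S \in SD) || (S \in SN) = ~~ interior_side S.
  by move/setP/(_ S): hb; rewrite !finset.in_setU inE.
have iy : is_rt y.
  split=> [S T TS|S iS x Sx].
    by eexists => x Sx; rewrite (radial_dot_normal nd ry TS Sx).
  rewrite (radial_trace nd ry Sx) -/nu.
  have := bdry S; rewrite iS => /negbT; rewrite !negb_or => /andP[/andP[SI' SD'] SN'].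
  by rewrite H// (negbTE SN').
have iy' : `[< is_rt y >] by apply/asboolP.
exists (exist (fun z : L1d M => is_true `[< is_rt z >]) y iy'); split; last first.
  by apply/funext => T; rewrite Pi_vec_hE//= field_of_center.
split=> [T|S SN' x Sx]; first exact: divergence_field_of.
rewrite (radial_trace nd ry Sx) -/nu H ?SN'//.
  apply/negP => SI'; move/setP/(_ S): IN.
  by rewrite finset.in_setI finset.in_set0 -/SI -/SN SI' SN'.
apply/negP => SD'; move/setP/(_ S): DN.
by rewrite finset.in_setI finset.in_set0 -/SD -/SN SD' SN'.
Qed.

Lemma adm_trace y S : adm y -> S \in SN -> side_trace (sval y) S = g S.
Proof.
move=> [_ yg] SN'; have [b bS E] := vtx0_side S.
by apply: yg => //; rewrite E; exact: pos_hull.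
Qed.

Lemma interior_trace y S : interior_side S -> side_trace (sval y) S = 0.
Proof.
move=> iS; have [b bS E] := vtx0_side S.
have /asboolP[_] := svalP y; apply => //; rewrite E; exact: pos_hull.
Qed.

(** Interior traces vanish, Neumann terms cancel, and on Dirichlet sides the means are
    prescribed. *)
Lemma adm_integrand y v : adm y -> K v ->
  - l2_dot (Pi_vec_h y) (grad_h v) - Fr v =
  - \sum_(S in SI) side_trace (sval y) S * pi_h v S * side_vol S
  - \sum_(S in SD) side_trace (sval y) S * uD S * side_vol S
  - (2 * m)^-1 * (\sum_(S in SI) `|pi_h v S| * side_vol S) ^+ 2.
Proof.
move=> ay Kv; have ry := RT_radial y.
rewrite (dual_integrand v ry ay.1); last by move=> T; rewrite Pi_vec_hE.
rewrite /Psi sum_sides.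
rewrite [X in _ - (X + _ + _ + _)]big1 ?add0r; last first.
  by move=> S iS; rewrite interior_trace// !mul0r.
have -> : \sum_(S in SD) side_trace (sval y) S * pi_h v S * side_vol S =
    \sum_(S in SD) side_trace (sval y) S * uD S * side_vol S.
  by apply: eq_bigr => S SD'; rewrite Kv.
have -> : \sum_(S in SN) side_trace (sval y) S * pi_h v S * side_vol S =
    \sum_(S in SN) g S * pi_h v S * side_vol S.
  by apply: eq_bigr => S SN'; rewrite adm_trace.
by ring.
Qed.

(** Hölder's inequality on the sides in [SI], then Young's inequality with weight [m]. *)
Lemma adm_integrand_le y v : adm y -> K v ->
  - l2_dot (Pi_vec_h y) (grad_h v) - Fr v <=
  m / 2 * linf_norm SI y ^+ 2
  - \sum_(S in SD) side_trace (sval y) S * uD S * side_vol S.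
Proof.
move=> ay Kv; rewrite adm_integrand//.
have [a0 aS _] := linf_normP nd SI (RT_radial y).
set a := linf_norm SI y in a0 aS *; set X := \sum_(S in SI) `|pi_h v S| * side_vol S.
have : - \sum_(S in SI) side_trace (sval y) S * pi_h v S * side_vol S <= a * X.
  rewrite -sumrN mulr_sumr; apply: ler_sum => S SI'.
  rewrite -mulNr [a * _]mulrA ler_pM2r ?side_vol_gt0//.
  rewrite (le_trans (ler_norm _))// normrN normrM; apply: ler_wpM2r => //.
  exact: aS.
have : 0 <= (2 * m)^-1 * (m * a - X) ^+ 2.
  by rewrite mulr_ge0 ?sqr_ge0// invr_ge0 mulr_ge0// ltW.
have -> : (2 * m)^-1 * (m * a - X) ^+ 2 = m / 2 * a ^+ 2 - a * X + (2 * m)^-1 * X ^+ 2.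
  by field; rewrite gt_eqF.
by lra.
Qed.

(** Equality in Hölder and Young: the means on [SI] are concentrated on one side of maximal trace,
    with opposite sign and total mass [m * a]. *)
Lemma adm_integrand_max y (v0 : CR M) : adm y -> K v0 ->
  exists2 v, K v & - l2_dot (Pi_vec_h y) (grad_h v) - Fr v =
  m / 2 * linf_norm SI y ^+ 2
  - \sum_(S in SD) side_trace (sval y) S * uD S * side_vol S.
Proof.
move=> ay Kv0; have [a0 aS aE] := linf_normP nd SI (RT_radial y).
set a := linf_norm SI y in a0 aS aE *.
have [hb ID IN DN] := hs.
pose nu := side_trace (sval y).
have [w [wD wnu wn]] : exists w : side M -> R,
  [/\ forall S, S \in SD -> w S = uD S,
   \sum_(S in SI) nu S * w S * side_vol S = - (m * a ^+ 2)
   & \sum_(S in SI) `|w S| * side_vol S = m * a].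
  case: aE => [->|[S0 S0I aE]].
    exists (fun S => if S \in SI then 0 else uD S); split.
    - move=> S SD'; move/setP/(_ S): ID.
      by rewrite finset.in_setI finset.in_set0 -/SI -/SD SD' andbT => ->.
    - rewrite big1 ?expr0n ?mulr0 ?oppr0// => S ->; by rewrite mulr0 mul0r.
    - rewrite big1 ?mulr0// => S ->; by rewrite normr0 mul0r.
  exists (fun S => if S \in SI then
      (if S == S0 then - (Num.sg (nu S0) * m * a / side_vol S0) else 0) else uD S).
  have V0 := side_vol_gt0 nd S0.
  have nua : `|nu S0| = a by rewrite aE.
  split.
  - move=> S SD'; move/setP/(_ S): ID.
    by rewrite finset.in_setI finset.in_set0 -/SI -/SD SD' andbT => ->.
  - rewrite (bigD1 S0)//= S0I eqxx big1 ?addr0; last first.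
      by move=> S /andP[-> /negbTE ->]; rewrite mulr0 mul0r.
    transitivity (- (m * (Num.sg (nu S0) * nu S0) * a)); last first.
      by rewrite -normrEsg nua; ring.
    by field; rewrite gt_eqF.
  - rewrite (bigD1 S0)//= S0I eqxx big1 ?addr0; last first.
      by move=> S /andP[-> /negbTE ->]; rewrite normr0 mul0r.
    rewrite normrN !normrM normfV (gtr0_norm V0) (gtr0_norm hm) (ger0_norm a0).
    rewrite divfK ?gt_eqF// normr_sg.
    (* A zero trace has sign 0, but then [a = 0] and the required mass is 0 as well. *)
    have [nu0|] := eqVneq (nu S0) 0; last by rewrite mul1r.
    by rewrite -nua nu0 normr0 !mulr0.
have [v vw] := pi_h_surj nd w.
have Kv : K v by move=> S SD'; rewrite vw wD.
exists v => //; rewrite adm_integrand// vw wnu wn.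
by field; rewrite gt_eqF.
Qed.

Let G := @G_h R n M.
Let Fconj p := conjugate F (fun v => - l2_dot p (grad_h v)).
Let dual p := fenchel_dual (@grad_h R n M) G F (l2_dot p).

Lemma D_rtE y : adm y -> D y = (- (2^-1 * l2_dot (Pi_vec_h y) (Pi_vec_h y))
  - (m / 2 * linf_norm SI y ^+ 2
     - \sum_(S in SD) side_trace (sval y) S * uD S * side_vol S))%:E.
Proof.
move=> ay; rewrite /D /D_rt asboolT//; congr _%:E.
by rewrite sides_int_trace//; [ring|exact: RT_radial].
Qed.

Lemma D_rtNadm y : ~ adm y -> D y = -oo%E.
Proof. by move=> ay; rewrite /D /D_rt asboolF. Qed.

(** The divergence fixes the linear part of a radial field, and the barycenter value then fixes the
    constant. *)
Lemma adm_inj y y' : adm y -> adm y' -> Pi_vec_h y = Pi_vec_h y' -> y = y'.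
Proof.
move=> ay ay' E; apply/val_inj/funext => T /=.
have ry := RT_radial y T; have ry' := RT_radial y' T.
have := congr1 (fun p : L0d M => p T) E; rewrite /= !Pi_vec_hE// /vaff ry ry'.
rewrite -![divergence _]/(div_h _ T) ay.1 ay'.1 => /addIr E1.
rewrite [LHS]surjective_pairing [RHS]surjective_pairing E1 ry ry'.
by rewrite -![divergence _]/(div_h _ T) ay.1 ay'.1.
Qed.

Lemma Fconj_le p r : (forall v, K v -> - l2_dot p (grad_h v) - Fr v <= r) ->
  (Fconj p <= r%:E)%E.
Proof.
move=> H; apply: ge_ereal_sup => _ [v _ <-]; rewrite /F /F_h.
case: asboolP => [Kv|_]; last by rewrite leNye.
by rewrite -EFinB lee_fin; exact: H.
Qed.

Lemma le_Fconj p v : K v -> ((- l2_dot p (grad_h v) - Fr v)%:E <= Fconj p)%E.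
Proof.
move=> Kv; apply: ereal_sup_ubound; exists v => //.
by rewrite /F /F_h asboolT// -EFinB.
Qed.

Lemma Fconj_adm y (v0 : CR M) : K v0 -> adm y ->
  Fconj (Pi_vec_h y) = (m / 2 * linf_norm SI y ^+ 2
     - \sum_(S in SD) side_trace (sval y) S * uD S * side_vol S)%:E.
Proof.
move=> Kv0 ay; apply/eqP; rewrite eq_le; apply/andP; split.
  by apply: Fconj_le => v; exact: adm_integrand_le.
by have [v Kv <-] := adm_integrand_max ay Kv0; exact: le_Fconj.
Qed.

Lemma dualE p : dual p = (- (2^-1 * l2_dot p p)%:E - Fconj p)%E.
Proof. by rewrite /dual /fenchel_dual conjugate_G_h. Qed.

Lemma D_rt_dual y (v0 : CR M) : K v0 -> adm y -> D y = dual (Pi_vec_h y).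
Proof.
by move=> Kv0 ay; rewrite dualE (Fconj_adm Kv0)// D_rtE// EFinB EFinN.
Qed.

(** An admissible representative of [p] is unique and carries the dual value. Without one, every
    [D y] is -oo; a finite conjugate would contradict [bounded_admissible], and [v0] rules out -oo,
    so the conjugate is +oo. *)
Lemma dual_sup p (v0 : CR M) : K v0 ->
  dual p = ereal_sup [set D y | y in [set y | Pi_vec_h y = p]].
Proof.
move=> Kv0; have [[y [ay yp]]|no] := pselect (exists y, adm y /\ Pi_vec_h y = p).
  rewrite -yp -(D_rt_dual Kv0)//; apply/eqP; rewrite eq_le; apply/andP; split.
    by apply: ereal_sup_ubound; exists y.
  apply: ge_ereal_sup => _ [y' /= yy' <-].
  have [ay'|ay'] := pselect (adm y'); last by rewrite D_rtNadm// leNye.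
  by rewrite (adm_inj ay' ay yy').
have -> : ereal_sup [set D y | y in [set y | Pi_vec_h y = p]] = -oo%E.
  apply/eqP; rewrite -leeNy_eq; apply: ge_ereal_sup => _ [y /= yp <-].
  by rewrite D_rtNadm// => ay; apply: no; exists y.
rewrite dualE; case E : (Fconj p) => [r| |]//.
  case: no; apply: (bounded_admissible (r := r) Kv0) => v Kv.
  by rewrite -lee_fin -E; exact: le_Fconj.
by have := le_Fconj p Kv0; rewrite E.
Qed.

Lemma I_crE v : K v -> Ic v = (2^-1 * l2_dot (grad_h v) (grad_h v) + Fr v)%:E.
Proof. by move=> Kv; rewrite /Ic /I_cr asboolT. Qed.

(** * Linearity of the means and convexity of the primal functional *)

Lemma pi_h_linear (a : R) (v v' : CR M) S :
  pi_h (a *: v + v') S = a * pi_h v S + pi_h v' S.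
Proof.
have /card_gt0P[T TS] := adj_gt0 S.
rewrite -!(pi_h_mean nd _ TS) !mean_side// mulrCA -mulrDr; congr (_ * _).
rewrite mulr_sumr -big_split; apply: eq_bigr => b _ /=.
exact: aff_linear.
Qed.

Lemma Pi_h_linear (a : R) (v v' : CR M) T :
  Pi_h (a *: v + v') T = a * Pi_h v T + Pi_h v' T.
Proof.
by rewrite /Pi_h !mean_cell//; exact: aff_linear.
Qed.

Lemma pi_h_conv (t : R) (v v' : CR M) S :
  pi_h (t *: v + (1 - t) *: v') S = t * pi_h v S + (1 - t) * pi_h v' S.
Proof.
rewrite pi_h_linear -[(1 - t) *: v']addr0 pi_h_linear.
(* This instance gives the mean of the zero function. *)
by have := pi_h_linear (-1) v v S; rewrite scaleN1r addNr => ->; ring.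
Qed.

Lemma Pi_h_conv (t : R) (v v' : CR M) T :
  Pi_h (t *: v + (1 - t) *: v') T = t * Pi_h v T + (1 - t) * Pi_h v' T.
Proof.
rewrite Pi_h_linear -[(1 - t) *: v']addr0 Pi_h_linear.
by have := Pi_h_linear (-1) v v T; rewrite scaleN1r addNr => ->; ring.
Qed.

Lemma K_conv (t : R) (v v' : CR M) : K v -> K v' -> K (t *: v + (1 - t) *: v').
Proof. by move=> Kv Kv' S SD'; rewrite pi_h_conv Kv// Kv'//; ring. Qed.

(** The load terms are linear; the weighted l1 norm [N] is convex and nonnegative, where squaring is
    monotone and convex. *)
Lemma F_real_conv (t : R) (v v' : CR M) : 0 < t < 1 ->
  Fr (t *: v + (1 - t) *: v') <= t * Fr v + (1 - t) * Fr v'.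
Proof.
move=> /andP[t0 t1]; rewrite !F_realE.
have -> : \sum_T f T * Pi_h (t *: v + (1 - t) *: v') T * cell_vol T =
    t * (\sum_T f T * Pi_h v T * cell_vol T) +
    (1 - t) * (\sum_T f T * Pi_h v' T * cell_vol T).
  rewrite !mulr_sumr -big_split; apply: eq_bigr => T _ /=.
  by rewrite Pi_h_conv; ring.
have -> : \sum_(S in SN) g S * pi_h (t *: v + (1 - t) *: v') S * side_vol S =
    t * (\sum_(S in SN) g S * pi_h v S * side_vol S) +
    (1 - t) * (\sum_(S in SN) g S * pi_h v' S * side_vol S).
  rewrite !mulr_sumr -big_split; apply: eq_bigr => S _ /=.
  by rewrite pi_h_conv; ring.
set N := fun v => \sum_(S in SI) `|pi_h v S| * side_vol S.
have N0 x : 0 <= N x.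
  by apply: sumr_ge0 => S _; rewrite mulr_ge0// ltW// side_vol_gt0.
have NC : N (t *: v + (1 - t) *: v') <= t * N v + (1 - t) * N v'.
  rewrite /N !mulr_sumr -big_split/=; apply: ler_sum => S _.
  rewrite pi_h_conv.
  move: (pi_h v S) (pi_h v' S) (side_vol S) (side_vol_gt0 nd S) => A B V V0.
  rewrite !mulrA -mulrDl ler_pM2r//.
  rewrite (le_trans (ler_normD _ _))// !normrM (gtr0_norm t0).
  by rewrite (gtr0_norm (_ : 0 < 1 - t)) ?subr_gt0.
rewrite -![\sum_(S in SI) _]/(N _).
have sq : N (t *: v + (1 - t) *: v') ^+ 2 <= t * N v ^+ 2 + (1 - t) * N v' ^+ 2.
  apply: (@le_trans _ _ ((t * N v + (1 - t) * N v') ^+ 2)).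
    by rewrite lerXn2r// nnegrE ?N0// (le_trans _ NC).
  rewrite -subr_ge0.
  rewrite (_ : _ - _ = t * (1 - t) * (N v - N v') ^+ 2); last by ring.
  by rewrite mulr_ge0 ?sqr_ge0// mulr_ge0 ?subr_ge0 ?ltW.
have c0 : 0 <= (2 * m)^-1 by rewrite invr_ge0 mulr_ge0// ltW.
have := ler_wpM2l c0 sq; rewrite mulrDr; lra.
Qed.

(** Written as a displacement from [v'], so that the squared norm expands in powers of [t]. *)
Lemma grad_h_conv (t : R) (v v' : CR M) :
  grad_h (t *: v + (1 - t) *: v') = grad_h v' + t *: (grad_h v - grad_h v').
Proof.
apply/funext => T.
have -> : grad_h (t *: v + (1 - t) *: v') T = t *: grad_h v T + (1 - t) *: grad_h v' T.
  by [].
rewrite (_ : (grad_h v' + t *: (grad_h v - grad_h v')) T =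
  grad_h v' T + t *: (grad_h v T - grad_h v' T))//.
by rewrite scalerBl scalerBr scale1r addrCA.
Qed.

(** * First-order optimality and strong duality *)

Section Minimizer.
Context (u : CR M) (Ku : K u) (umin : forall v, (Ic u <= Ic v)%E).
Let p := grad_h u.

(** The energy is compared along the segment from [u] to [v]: convexity bounds the change of [Fr]
    linearly in [t], and [quad_nonneg] discards the quadratic remainder. *)
Lemma minimizer_variation v : K v ->
  - l2_dot p (grad_h v) - Fr v <= - l2_dot p p - Fr u.
Proof.
move=> Kv; set q := grad_h v.
suff : 0 <= l2_dot p (q - p) + Fr v - Fr u by rewrite l2_dotB//; lra.
apply: (@quad_nonneg _ _ (2^-1 * l2_dot (q - p) (q - p))) => t t01.
have := umin (t *: v + (1 - t) *: u).
rewrite !I_crE//; last exact: K_conv.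
rewrite lee_fin grad_h_conv -/p -/q.
have := F_real_conv v u t01; move: (q - p) => d.
rewrite l2_dotD// l2_dotZ// !(l2_dotC nd (p + _)) !l2_dotD// !l2_dotZ//.
rewrite (l2_dotC nd d p); lra.
Qed.

Lemma Fconj_minimizer : Fconj p = (- l2_dot p p - Fr u)%:E.
Proof.
apply/eqP; rewrite eq_le le_Fconj// andbT.
by apply: Fconj_le => v; exact: minimizer_variation.
Qed.

(** The conjugate is bounded below by its integrand at [u]. The square is kept because it yields
    uniqueness. *)
Lemma D_rt_le y : adm y ->
  (D y <= (2^-1 * l2_dot p p + Fr u -
    2^-1 * l2_dot (Pi_vec_h y - p) (Pi_vec_h y - p))%:E)%E.
Proof.
move=> ay; have := le_Fconj (Pi_vec_h y) Ku.
rewrite (Fconj_adm Ku ay) D_rtE// !lee_fin l2_sqrB// -/p; lra.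
Qed.

Lemma strong_duality : exists z,
  [/\ adm z, Pi_vec_h z = p, D z = Ic u &
      forall y, (D y <= D z)%E /\ (D z <= D y -> y = z)%E].
Proof.
have [z [az zp]] := bounded_admissible Ku minimizer_variation.
have Dz : D z = Ic u.
  rewrite (D_rt_dual Ku az) zp dualE Fconj_minimizer I_crE// -/p.
  by rewrite -EFinN -EFinB; congr _%:E; lra.
exists z; split => // y; rewrite Dz I_crE// -/p.
have [ay|ay] := pselect (adm y); last by rewrite D_rtNadm// leNye; split.
have Dy := D_rt_le ay; have q0 := l2_dot_ge0 nd (Pi_vec_h y - p).
split; first by rewrite (le_trans Dy)// lee_fin; lra.
move=> /le_trans/(_ Dy); rewrite lee_fin => H.
have /(l2_dot_eq0 nd)/eqP : l2_dot (Pi_vec_h y - p) (Pi_vec_h y - p) = 0 by lra.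
rewrite subr_eq0 => /eqP yp; apply: adm_inj => //.
by rewrite yp zp.
Qed.

(** The conjugate at [p] is known twice, explicitly through [z] and as the value at [u]; comparing
    with [adm_integrand] at [u] cancels the Dirichlet terms. *)
Lemma optimality z : adm z -> Pi_vec_h z = p ->
  - \sum_(S in SI) side_trace (sval z) S * pi_h u S * side_vol S =
  m / 2 * linf_norm SI z ^+ 2 +
  (2 * m)^-1 * (\sum_(S in SI) `|pi_h u S| * side_vol S) ^+ 2.
Proof.
move=> az zp; have := Fconj_adm Ku az; rewrite zp Fconj_minimizer => -[].
by have := adm_integrand az Ku; rewrite zp -/p; lra.
Qed.

End Minimizer.
End Duality.

(** * Convexity and semicontinuity *)

Section Splitting.
Context {R : realType} {n : nat} {M : mesh R n.+1}.
Context (nd : forall A, A \in cells M -> nondegenerate_cell A).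
Context (GI GD GN : set 'rV[R]_n.+1).
Context (m : R) (hm : 0 < m) (f : cell M -> R) (g uD : side M -> R).

Lemma lsc_continuous (X : topologicalType) (h : X -> R) :
  continuous h -> lower_semicontinuous (fun x => (h x)%:E).
Proof.
move=> ch x a; rewrite lte_fin => ax.
exists [set y | a < h y]; last by move=> y; rewrite lte_fin.
apply: (ch x [set z | a < z]); apply: open_nbhs_nbhs; split => //.
Qed.

Lemma continuous_sum (X : topologicalType) (I : finType) (P : pred I)
    (h : I -> X -> R) : (forall i, continuous (h i)) ->
  continuous (fun x => \sum_(i | P i) h i x).
Proof. move=> ch x; apply: cvg_big => [|i _]; last exact: ch.
by move=> z; exact: add_continuous. Qed.

Lemma continuous_add (X : topologicalType) (h k : X -> R) :
  continuous h -> continuous k -> continuous (fun x => h x + k x).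
Proof. by move=> ch ck x; apply: cvgD; [exact: ch|exact: ck]. Qed.

Lemma continuous_mul (X : topologicalType) (h k : X -> R) :
  continuous h -> continuous k -> continuous (fun x => h x * k x).
Proof. by move=> ch ck x; apply: cvgM; [exact: ch|exact: ck]. Qed.

Lemma continuous_opp (X : topologicalType) (h : X -> R) :
  continuous h -> continuous (fun x => - h x).
Proof. by move=> ch x; apply: cvgN; exact: ch. Qed.

Lemma continuous_norm (X : topologicalType) (h : X -> R) :
  continuous h -> continuous (fun x => `|h x|).
Proof. by move=> ch x; apply: cvg_norm; exact: ch. Qed.

Lemma continuous_coord (T : cell M) : continuous (fun v : L1 M => v T).
Proof. exact: proj_continuous. Qed.

Lemma continuous_dot (X : topologicalType) (h k : X -> 'rV[R]_n.+1) :
  continuous h -> continuous k -> continuous (fun x => dot (h x) (k x)).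
Proof.
move=> ch ck; under eq_fun do rewrite dotE.
apply: continuous_sum => i x; apply: cvgM.
  exact: (continuous_comp (ch x) (@coord_continuous _ _ _ 0 i (h x))).
exact: (continuous_comp (ck x) (@coord_continuous _ _ _ 0 i (k x))).
Qed.

Lemma continuous_cr (T : cell M) : continuous (fun v : CR M => sval v T).
Proof.
move=> v; apply: (@continuous_comp _ _ _ (fun v : CR M => sval v : L1 M)
  (fun v : L1 M => v T)); first exact: initial_continuous.
exact: continuous_coord.
Qed.

Lemma continuous_grad (T : cell M) : continuous (fun v : CR M => grad (sval v T)).
Proof.
by move=> v; exact: (continuous_comp (@continuous_cr T v) (@cvg_snd _ _ _ _ _)).
Qed.

Lemma continuous_aff (T : cell M) x : continuous (fun v : CR M => aff (sval v T) x).
Proof.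
apply: continuous_add.
  by move=> v; exact: (continuous_comp (@continuous_cr T v) (@cvg_fst _ _ _ _ _)).
by apply: continuous_dot; [exact: continuous_grad|exact: cst_continuous].
Qed.

Lemma continuous_pi_h S : continuous (fun v : CR M => pi_h v S).
Proof.
have /card_gt0P[T TS] := adj_gt0 S.
under eq_fun do rewrite -(pi_h_mean nd _ TS) mean_side//.
apply: continuous_mul; first exact: cst_continuous.
by apply: continuous_sum => a; exact: continuous_aff.
Qed.

Lemma continuous_Pi_h T : continuous (fun v : CR M => Pi_h v T).
Proof.
rewrite /Pi_h; under eq_fun do rewrite mean_cell//.
exact: continuous_aff.
Qed.

Lemma continuous_F_real : continuous (fun v : CR M => F_real GI GN m f g v).
Proof.
under eq_fun do rewrite F_realE// expr2.
have cI : continuous (fun v : CR M =>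
    \sum_(S in sides_in M GI) `|pi_h v S| * side_vol S).
  apply: continuous_sum => S; apply: continuous_mul; last exact: cst_continuous.
  by apply: continuous_norm; exact: continuous_pi_h.
apply: continuous_add; first apply: continuous_add.
- apply: continuous_mul; first exact: cst_continuous.
  exact: continuous_mul.
- apply: continuous_opp; apply: continuous_sum => T.
  apply: continuous_mul; last exact: cst_continuous.
  by apply: continuous_mul; [exact: cst_continuous|exact: continuous_Pi_h].
- apply: continuous_opp; apply: continuous_sum => S.
  apply: continuous_mul; last exact: cst_continuous.
  by apply: continuous_mul; [exact: cst_continuous|exact: continuous_pi_h].
Qed.

Lemma continuous_grad_h : continuous (@grad_h R n M).
Proof.
move=> v.
have FF : Filter (nbhs (v : CR M)) := @nbhs_filter (CR M) v.
apply/cvg_sup => T.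
apply: (@continuous_comp_initial _ (CR M) _ (fun p : L0d M => p T)).
exact: continuous_grad.
Qed.

Lemma G_h_splitting : [/\ proper_fun (@G_h R n M), convex_efun (@G_h R n M)
  & lower_semicontinuous (@G_h R n M)].
Proof.
split.
- by split => [p|]; [|exists 0].
- move=> p q t /andP[t0 t1]; rewrite /G_h -!EFinM -EFinD lee_fin.
  (* With [p = q + d], the convexity gap is t(1-t)/2 times the squared norm of [d]. *)
  have [d ->] : exists d, p = q + d by exists (p - q); rewrite addrC subrK.
  have -> : t *: (q + d) + (1 - t) *: q = q + t *: d.
    rewrite scalerDr scalerBl scale1r addrC -addrA; congr (q + _).
    by rewrite addrA addNr add0r.
  have := l2_dot_ge0 nd d.
  rewrite !l2_sqrD// !l2_dotZ// (l2_dotC nd (t *: d)) l2_dotZ// => H.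
  have t1' : 0 <= 1 - t by rewrite subr_ge0 ltW.
  by have := mulr_ge0 (mulr_ge0 (ltW t0) t1') H; lra.
- apply: lsc_continuous; under eq_fun do rewrite l2_dotE//.
  apply: continuous_mul; first exact: cst_continuous.
  apply: continuous_sum => T; apply: continuous_mul; last exact: cst_continuous.
  by apply: continuous_dot; exact: (@proj_continuous (cell M) (fun=> 'rV[R]_n.+1)).
Qed.

Lemma F_h_splitting (v0 : CR M) : K_cr GD uD v0 ->
  let F := F_h GI GD GN m f g uD in
  [/\ proper_fun F, convex_efun F & lower_semicontinuous F].
Proof.
move=> Kv0 F; split.
- split=> [v|]; first by rewrite /F /F_h; case: asboolP.
  by exists v0; rewrite /F /F_h asboolT.
- move=> v w t t01; rewrite /F /F_h; have /andP[t0 t1] := t01.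
  case: (asboolP (K_cr GD uD v)) => Kv; last first.
    rewrite [X in (_ <= X + _)%E]gt0_muley ?lte_fin// addye ?leey//.
    by case: asboolP => _; rewrite -?EFinM// gt0_muley// lte_fin subr_gt0.
  case: (asboolP (K_cr GD uD w)) => Kw; last first.
    by rewrite [X in (_ <= _ + X)%E]gt0_muley ?lte_fin ?subr_gt0// -EFinM addey ?leey.
  rewrite asboolT; last exact: K_conv.
  by rewrite -!EFinM -EFinD lee_fin; apply: F_real_conv.
- move=> v a; rewrite /F /F_h; case: asboolP => [Kv av|nKv _].
    have [V vV VP] := lsc_continuous continuous_F_real av.
    exists V => // w Vw; case: asboolP => _; last by rewrite ltry.
    exact: VP.
  (* Outside the domain some Dirichlet condition fails; it keeps failing on a neighbourhood, where
     the functional is +oo. *)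
  have [S [SD vS]] : exists S, S \in sides_in M GD /\ pi_h v S != uD S.
    apply: contrapT => H; apply: nKv => S SD; apply/eqP/negPn/negP => vS.
    by apply: H; exists S.
  exists [set w | pi_h w S != uD S].
    apply: (@continuous_pi_h S v [set r | r != uD S]).
    by apply: open_nbhs_nbhs; split => //; exact: open_neq.
  move=> w /= wS; case: asboolP => [Kw|_]; last by rewrite ltry.
  by rewrite Kw// eqxx in wS.
Qed.

Lemma I_cr_splitting (v0 : CR M) : K_cr GD uD v0 ->
  fenchel_splitting (@grad_h R n M) (@G_h R n M) (F_h GI GD GN m f g uD)
    (I_cr GI GD GN m f g uD).
Proof.
move=> Kv0; split.
- by split; [move=> a v w|exact: continuous_grad_h].
- exact: G_h_splitting.
- exact: F_h_splitting Kv0.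
- move=> v; rewrite /I_cr /F_h /G_h; case: asboolP => _; first by rewrite EFinD.
  by rewrite addey.
Qed.

End Splitting.

Theorem theorem5p1 (R : realType) (n : nat)
    (Omega GI GD GN : set 'rV[R]_n.+1) (M : mesh R n.+1)
    (m : R) (f : cell M -> R) (g uD : side M -> R) (u : CR M)
    (hOmega : lipschitz_domain Omega)
    (hparts : boundary_parts Omega GI GD GN)
    (hM : triangulation M Omega)
    (hsides : compatible_sides M GI GD GN)
    (hm : 0 < m)
    (hu : K_cr GD uD u)
    (hmin : forall v : CR M,
      (I_cr GI GD GN m f g uD u <= I_cr GI GD GN m f g uD v)%E) :
  let I := I_cr GI GD GN m f g uD in
  let D := D_rt GI GD GN m f g uD in
  let G := @G_h R n M in
  let F := F_h GI GD GN m f g uD in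
  let dual := fun p : L0d M => fenchel_dual (@grad_h R n M) G F (l2_dot p) in
  [/\ fenchel_splitting (@grad_h R n M) G F I,
      forall p, dual p = ereal_sup [set D y | y in [set y | Pi_vec_h y = p]]
    & forall y, D y <> -oo%E -> D y = dual (Pi_vec_h y)]
  /\
  exists z : RT M,
    [/\ unique (fun z => forall y, (D y <= D z)%E) z,
        forall T, div_h z T = - f T,
        forall S, S \in sides_in M GN ->
          forall x, hull (sval S) x -> normal_trace (sval z) S x = g S,
        I u = D z
      & Pi_vec_h z = grad_h u /\
        - sides_int (sides_in M GI)
            (fun S x => normal_trace (sval z) S x * pi_h u S) =
          m / 2 * linf_norm (sides_in M GI) z ^+ 2
          + (2 * m)^-1 * l1_norm (sides_in M GI) (pi_h u) ^+ 2].
Proof.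
have nd A : A \in cells M -> nondegenerate_cell A by case: hM => _ + _ _; exact.
move=> I D G F dual; split.
  split; [exact: I_cr_splitting hu|move=> p; exact: dual_sup hu|].
  move=> y Dy; apply: (D_rt_dual nd hsides hm hu).
  by have [//|/D_rtNadm] := pselect (rt_admissible GN f g y); move/(_ GI GD m uD).
have [z [az zp Dz zmax]] := strong_duality nd hsides hm hu hmin.
exists z; split; [|exact: az.1|exact: az.2|exact: esym Dz|split=> //].
  split=> [y|z' z'max]; first by case: (zmax y).
  (* A second maximizer [z'] satisfies [D z <= D z'], the equality case of [strong_duality]. *)
  by apply/esym; apply: (zmax z').2; exact: z'max.
rewrite sides_int_trace//; last exact: RT_radial.
by rewrite (optimality nd hsides hm hu hmin az zp) /l1_norm sides_int_cst.
Qed.
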